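(* Let $\mathcal{R}=\mathcal{R}_0\oplus\mathcal{R}_1$ be a finite-dimensional non-nilpotent complex solvable Lie superalgebra with nilradical $\mathcal{N}$ such that $[\mathcal{R},\mathcal{R}]\subseteq\mathcal{N}$ and $[\mathcal{R}_1,\mathcal{R}_1]\subseteq[\mathcal{R}_0,\mathcal{R}_0]$. Then $\mathcal{R}$ is (up to isomorphism) a solvable Lie superalgebra of maximal rank if and only if $\mathcal{R}$ is a maximal solvable extension of a nilpotent Lie superalgebra of maximal rank.
   Context: All spaces are finite-dimensional over $\mathbb{C}$. A Lie superalgebra $\mathcal{L}=\mathcal{L}_0\oplus\mathcal{L}_1$ is a $\mathbb{Z}_2$-graded vector space with an even bilinear bracket satisfying super skew-symmetry and the super Jacobi identity. The nilradical is the maximal nilpotent ideal. An even superderivation of $\mathcal{L}$ is a parity-preserving linear map $d$ with $d([x,y])=[d(x),y]+[x,d(y)]$. A torus of $\mathcal{L}$ is a commuting Lie algebra of diagonalizable even superderivations of $\mathcal{L}$; a maximal torus $\mathcal{T}_{max}$ is one not strictly contained in another torus (all maximal tori of a nilpotent Lie superalgebra have the same dimension). A nilpotent Lie superalgebra $\mathcal{N}$ is of maximal rank if $\dim\mathcal{T}_{max}=\dim(\mathcal{N}/[\mathcal{N},\mathcal{N}])$. For a nilpotent Lie superalgebra $\mathcal{N}$ and a maximal torus $\mathcal{T}_{max}$ of $\mathcal{N}$, $\mathcal{R}_{\mathcal{T}_{max}}=\mathcal{N}\dot{+}\mathcal{T}_{max}$ is the solvable Lie superalgebra (with $\mathcal{T}_{max}$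 even) extending the bracket of $\mathcal{N}$ by $[x,d]=d(x)$, $[d,d']=0$ for $x\in\mathcal{N}$, $d,d'\in\mathcal{T}_{max}$. A solvable Lie superalgebra $\mathcal{R}_{\mathcal{T}_{max}}$ is of maximal rank if $\dim\mathcal{T}_{max}=\dim(\mathcal{N}/[\mathcal{N},\mathcal{N}])$. A maximal solvable extension of $\mathcal{N}$ is a solvable Lie superalgebra $\mathcal{R}$ with nilradical $\mathcal{N}$ such that $\dim(\mathcal{R}/\mathcal{N})$ is maximal among solvable Lie superalgebras $\mathcal{R}'=\mathcal{R}'_0\oplus\mathcal{R}'_1$ with nilradical $\mathcal{N}$ satisfying $[\mathcal{R}',\mathcal{R}']\subseteq\mathcal{N}$ and $[\mathcal{R}'_1,\mathcal{R}'_1]\subseteq[\mathcal{R}'_0,\mathcal{R}'_0]$. *)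

(* Defs.v *)
From HB Require Import structures.
From mathcomp Require Import all_boot all_order all_algebra.

Set Implicit Arguments.
Unset Strict Implicit.
Unset Printing Implicit Defensive.

Import GRing.Theory.
Local Open Scope ring_scope.

(* [grade false] is the even part and [grade true] the odd part, so that the
   sum of two parities is [(+)] and the sign (-1)^(ij) is (-1) ^+ (i && j). *)
HB.mixin Record Vector_isLieSuperalgebra (K : fieldType) L of Vector K L := {
  grade : bool -> {vspace L};
  bra : L -> L -> L;
  grade_full : (grade false + grade true = fullv)%VS;
  grade_direct : (grade false :&: grade true = 0)%VS;
  bra_linear_l : forall y, linear (fun x => bra x y);
  bra_linear_r : forall x, linear (bra x);
  bra_grade : forall i j x y, x \in grade i -> y \in grade j ->
    bra x y \in grade (i (+) j);
  bra_skew : forall i j x y, x \in grade i -> y \in grade j ->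
    bra x y = - ((-1) ^+ (i && j) *: bra y x);
  bra_jacobi : forall i j k x y z,
    x \in grade i -> y \in grade j -> z \in grade k ->
    bra x (bra y z) = bra (bra x y) z + (-1) ^+ (i && j) *: bra y (bra x z)
}.

#[short(type="lieSuperalgType")]
HB.structure Definition LieSuperalgebra (K : fieldType) :=
  { L of Vector K L & Vector_isLieSuperalgebra K L }.

Section BracketTheory.
Variables (K : fieldType) (L : lieSuperalgType K).
Implicit Types (x y z : L) (U W X : {vspace L}).

HB.instance Definition _ (x : L) :=
  GRing.isLinear.Build K L L _ (@bra K L x) (@bra_linear_r K L x).

Definition brar (y x : L) := bra x y.

HB.instance Definition _ (y : L) :=
  GRing.isLinear.Build K L L _ (brar y) (@bra_linear_l K L y).

Lemma braDl y x x' : bra (x + x') y = bra x y + bra x' y.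
Proof. exact: (raddfD (brar y)). Qed.
Lemma braNl y x : bra (- x) y = - bra x y.
Proof. exact: (raddfN (brar y)). Qed.
Lemma bra0l y : bra 0 y = 0 :> L.
Proof. exact: (raddf0 (brar y)). Qed.
Lemma braZl a y x : bra (a *: x) y = a *: bra x y.
Proof. exact: (linearZZ (brar y)). Qed.
Lemma braDr x y y' : bra x (y + y') = bra x y + bra x y'.
Proof. exact: raddfD. Qed.
Lemma braNr x y : bra x (- y) = - bra x y.
Proof. exact: raddfN. Qed.
Lemma bra0r x : bra x 0 = 0 :> L.
Proof. exact: raddf0. Qed.
Lemma braZr a x y : bra x (a *: y) = a *: bra x y.
Proof. exact: linearZZ. Qed.

(* [U, W]; by bilinearity it is enough to bracket bases, see [brsP]. *)
Definition brs U W : {vspace L} :=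
  <<[seq bra x y | x <- vbasis U, y <- vbasis W]>>%VS.

Lemma memv_brs U W x y : x \in U -> y \in W -> bra x y \in brs U W.
Proof.
move=> xU yW; rewrite (coord_vbasis xU) -/(brar y _) linear_sum.
apply: memv_suml => i _; rewrite linearZZ memvZ //= /brar.
rewrite (coord_vbasis yW) linear_sum; apply: memv_suml => j _ /=.
rewrite linearZZ memvZ // memv_span //; apply/allpairsP.
by exists ((vbasis U)`_i, (vbasis W)`_j); split=> //=; apply: mem_nth;
  rewrite size_tuple.
Qed.

Lemma brsP U W X :
  (forall x y, x \in U -> y \in W -> bra x y \in X) <-> (brs U W <= X)%VS.
Proof.
split=> [h | /subvP h x y xU yW]; last exact/h/memv_brs.
by apply/span_subvP => _ /allpairsP[[x y] /= [/vbasis_mem xU /vbasis_mem yW ->]];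
  apply: h.
Qed.

End BracketTheory.

Section Notions.
Variable K : fieldType.
Implicit Types L N : lieSuperalgType K.

(* The dimension of the quotient L / U. *)
Definition codimv L (U : {vspace L}) : nat := (\dim {:L} - \dim U)%N.

Fixpoint lower_central L (U : {vspace L}) (n : nat) : {vspace L} :=
  if n is m.+1 then brs (lower_central U m) U else U.

Fixpoint derived_series L (U : {vspace L}) (n : nat) : {vspace L} :=
  if n is m.+1 then brs (derived_series U m) (derived_series U m) else U.

Definition nilpotent_lsa L (U : {vspace L}) : Prop :=
  exists n, lower_central U n = 0%VS.

Definition solvable_lsa L (U : {vspace L}) : Prop :=
  exists n, derived_series U n = 0%VS.

Definition graded_subspace L (U : {vspace L}) : Prop :=
  U = (U :&: grade false + U :&: grade true)%VS.

Definition graded_ideal L (I : {vspace L}) : Prop :=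
  graded_subspace I /\ (brs I fullv <= I)%VS.

(* Ideals of a superalgebra are graded; the sum of two nilpotent ideals is
   nilpotent, so the maximal one is the largest. *)
Definition is_nilradical L (N : {vspace L}) : Prop :=
  [/\ graded_ideal N, nilpotent_lsa N &
      forall I : {vspace L}, graded_ideal I -> nilpotent_lsa I -> (I <= N)%VS].

Definition lsa_hom N L (f : 'Hom(N, L)) : Prop :=
  (forall i, (f @: grade i <= grade i)%VS) /\
  (forall x y, f (bra x y) = bra (f x) (f y)).

(* [N] is isomorphic to the graded subalgebra [U] of [L]. *)
Definition lsa_isom_onto N L (U : {vspace L}) : Prop :=
  exists f : 'Hom(N, L), [/\ lsa_hom f, lker f = 0%VS & limg f = U].

Definition even_superderivation N (d : 'End(N)) : Prop :=
  (forall i, (d @: grade i <= grade i)%VS) /\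
  (forall x y, d (bra x y) = bra (d x) y + bra x (d y)).

Definition diagonalizable_end N (d : 'End(N)) : Prop :=
  exists2 b : seq N, basis_of fullv b &
    forall v, v \in b -> exists a : K, d v = a *: v.

Definition torus N (T : {vspace 'End(N)}) : Prop :=
  [/\ forall d, d \in T -> even_superderivation d,
      forall d, d \in T -> diagonalizable_end d &
      forall d e, d \in T -> e \in T -> (d \o e = e \o d)%VF].

Definition maximal_torus N (T : {vspace 'End(N)}) : Prop :=
  torus T /\ forall T' : {vspace 'End(N)}, torus T' -> (T <= T')%VS -> T' = T.

Definition of_maximal_rank N (T : {vspace 'End(N)}) : Prop :=
  \dim T = codimv (brs {:N} {:N}).

(* All maximal tori of a nilpotent [N] have the same dimension, so the choice of
   [T] is immaterial. *)
Definition nilpotent_of_maximal_rank N : Prop :=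
  nilpotent_lsa {:N} /\
  exists2 T : {vspace 'End(N)}, maximal_torus T & of_maximal_rank T.

End Notions.

Section TorusExtension.
Variables (K : fieldType) (N : lieSuperalgType K) (T : {vspace 'End(N)}).

Definition torus_ext of torus T := (N * subvs_of T)%type.

Hypothesis hT : torus T.
Local Notation R := (torus_ext hT).

HB.instance Definition _ := Vector.on R.

Definition ext_grade (i : bool) : {vspace R} :=
  (linfun (fst : R -> N) @^-1: grade i :&:
   (if i then lker (linfun (snd : R -> subvs_of T)) else fullv))%VS.

(* The semidirect sum N + T, with T even:
   [x + d, y + e] = [x, y] + e(x) - d(y), because [x, d] = d(x). *)
Definition ext_bra (u v : R) : R :=
  (bra u.1 v.1 + vsval v.2 u.1 - vsval u.2 v.1, 0).

Lemma ext_gradeP i u :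
  reflect (u.1 \in grade i /\ (i -> u.2 = 0)) (u \in ext_grade i).
Proof.
rewrite memv_cap -memv_preim lfunE /=.
apply: (iffP andP) => -[-> h]; split=> //; case: i h => //=.
- by rewrite memv_ker lfunE /= => /eqP.
- by move=> h; rewrite memv_ker lfunE /= h.
- by rewrite memvf.
Qed.

Lemma ext_full : (ext_grade false + ext_grade true = fullv)%VS.
Proof.
apply/eqP; rewrite eqEsubv subvf; apply/subvP => -[x d] _.
have: x \in (grade false + grade true)%VS by rewrite grade_full memvf.
case/memv_addP=> x0 hx0 [x1 hx1 ->].
apply/memv_addP; exists ((x0, d) : R); first exact/ext_gradeP.
exists ((x1, 0) : R); first exact/ext_gradeP.
by congr pair; rewrite /= addr0.
Qed.

Lemma ext_direct : (ext_grade false :&: ext_grade true = 0)%VS.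
Proof.
apply/eqP; rewrite -subv0; apply/subvP => -[x d].
rewrite memv_cap => /andP[/ext_gradeP[/= x0 _] /ext_gradeP[/= x1 /(_ isT) ->]].
have: x \in (grade false :&: grade true)%VS by rewrite memv_cap x0 x1.
by rewrite grade_direct !memv0 => /eqP->.
Qed.

Lemma ext_linear_l v : linear (fun u => ext_bra u v).
Proof.
move=> a u w; rewrite /ext_bra; congr pair; last by rewrite /= scaler0 addr0.
rewrite /= braDl braZl !linearP /= add_lfunE scale_lfunE scalerBr scalerDr opprD.
by rewrite (AC ((2*2)*2) (((1*3)*5)*((2*4)*6))).
Qed.

Lemma ext_linear_r u : linear (ext_bra u).
Proof.
move=> a v w; rewrite /ext_bra; congr pair; last by rewrite /= scaler0 addr0.
rewrite /= braDr braZr !linearP /= add_lfunE scale_lfunE !scalerDr.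
by rewrite (AC ((2*2)*2) (((1*3)*5)*((2*4)*6))).
Qed.

Lemma ext_gradeD i j u v : u \in ext_grade i -> v \in ext_grade j ->
  ext_bra u v \in ext_grade (i (+) j).
Proof.
have [evT _ _] := hT.
move=> /ext_gradeP[u1 u2] /ext_gradeP[v1 v2]; apply/ext_gradeP; split=> //=.
have stab k (d : subvs_of T) x : x \in grade k -> vsval d x \in grade k.
  move=> xk; have [/(_ k)/subvP h _] := evT _ (subvsP d).
  exact/h/memv_img.
rewrite memvB ?memvD ?bra_grade //.
  case: j v1 v2 => v1 v2; last by rewrite addbF; apply: stab.
  by rewrite v2 // raddf0 lfunE /= mem0v.
case: i u1 u2 => u1 u2; last by apply: stab.
by rewrite u2 // raddf0 lfunE /= mem0v.
Qed.

Lemma ext_skew i j u v : u \in ext_grade i -> v \in ext_grade j ->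
  ext_bra u v = - ((-1) ^+ (i && j) *: ext_bra v u).
Proof.
move=> /ext_gradeP[u1 u2] /ext_gradeP[v1 v2].
rewrite /ext_bra; congr pair; last by rewrite /= scaler0 oppr0.
rewrite /= (bra_skew _ _ _ _ u1 v1).
case: i j u1 u2 v1 v2 => -[] u1 u2 v1 v2 /=;
  rewrite ?(u2 isT) ?(v2 isT) ?raddf0 ?scale1r ?zero_lfunE ?subr0 ?addr0 //.
all: by rewrite ?opprD ?opprK // addrAC.
Qed.

Lemma ext_jacobi i j k u v w :
  u \in ext_grade i -> v \in ext_grade j -> w \in ext_grade k ->
  ext_bra u (ext_bra v w) =
  ext_bra (ext_bra u v) w + (-1) ^+ (i && j) *: ext_bra v (ext_bra u w).
Proof.
have [evT _ cT] := hT.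
have der (d : subvs_of T) : forall x y : N,
    vsval d (bra x y) = bra (vsval d x) y + bra x (vsval d y).
  by have [_] := evT _ (subvsP d).
have com (d e : subvs_of T) x : vsval d (vsval e x) = vsval e (vsval d x).
  by rewrite -!comp_lfunE cT ?subvsP.
have stab l (d : subvs_of T) x : x \in grade l -> vsval d x \in grade l.
  move=> xl; have [/(_ l)/subvP h _] := evT _ (subvsP d).
  exact/h/memv_img.
case: u v w => [x d] [y e] [z f].
move=> /ext_gradeP[/= xi di] /ext_gradeP[/= yj ej] /ext_gradeP[/= zk fk].
rewrite /ext_bra; congr pair; last by rewrite /= scaler0 addr0.
have sfe : (-1) ^+ (i && j) *: vsval f (vsval e x) = vsval f (vsval e x) :> N.
  case: i j di ej {xi yj} => -[] //= di ej; rewrite ?scale1r //.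
  by rewrite ej //= zero_lfunE !raddf0.
have sed : (-1) ^+ (i && j) *: vsval e (vsval d z) = vsval d (vsval e z) :> N.
  clear sfe; case: i j di ej {xi yj} => -[] //= di ej; rewrite ?scale1r ?(com e d) //.
  by rewrite di ?ej //= !zero_lfunE scaler0.
have sey : (-1) ^+ (i && j) *: vsval e (bra x z)= vsval e (bra x z) :> N.
  clear sfe sed; case: i j di ej {xi yj} => -[] //= di ej; rewrite ?scale1r //.
  by rewrite ej //= zero_lfunE scaler0.
have sdz : (-1) ^+ (i && j) *: bra y (vsval d z) = bra y (vsval d z) :> N.
  clear sfe sed sey; case: i j di ej {xi yj} => -[] //= di ej; rewrite ?scale1r //.
  by rewrite di //= zero_lfunE bra0r scaler0.
rewrite /= !zero_lfunE !addr0 subr0 !(raddfD, raddfN) /= !der.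
rewrite ?braDr ?braNr !braDl !braNl (bra_jacobi _ _ _ _ _ _ xi yj zk).
rewrite (bra_skew _ _ _ _ (stab _ f _ xi) yj).
rewrite !(scalerDr, scalerN) (com e f) (com d f) sfe sed sdz.
rewrite der scalerDr in sey; rewrite sey !opprD !opprK.
rewrite [RHS](AC ((3*4)*(3*4))
  ((1*8*5*12)*(3*10*7*14)*(2*11)*(9*4)*(6*13))).
by rewrite /= !subrr !addr0.
Qed.

HB.instance Definition _ := Vector_isLieSuperalgebra.Build K R
  ext_full ext_direct ext_linear_l ext_linear_r ext_gradeD ext_skew ext_jacobi.

End TorusExtension.

Section MaximalRank.
Variable K : fieldType.
Implicit Types L N : lieSuperalgType K.

Definition lsa_isom L1 L2 : Prop := lsa_isom_onto L1 {:L2}.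

Definition solvable_of_maximal_rank L : Prop :=
  exists (N : lieSuperalgType K) (T : {vspace 'End(N)}) (hT : torus T),
    [/\ nilpotent_lsa {:N}, maximal_torus T, of_maximal_rank T &
        lsa_isom L (torus_ext hT)].

Definition bracket_conditions L (N : {vspace L}) : Prop :=
  (brs {:L} {:L} <= N)%VS /\
  (brs (grade true : {vspace L}) (grade true) <=
     brs (grade false) (grade false))%VS.

Definition solvable_extension N L (U : {vspace L}) : Prop :=
  [/\ solvable_lsa {:L}, is_nilradical U, lsa_isom_onto N U & bracket_conditions U].

(* "With nilradical N" is read up to isomorphism, so that the competitors [L']
   range over all Lie superalgebras and [U'] is the copy of N in [L']. *)
Definition maximal_solvable_extension N L : Prop :=
  exists2 U : {vspace L}, solvable_extension N U &
    forall (L' : lieSuperalgType K) (U' : {vspace L'}),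
      solvable_extension N U' -> (codimv U' <= codimv U)%N.

End MaximalRank.

(* Main.v *)
From HB Require Import structures.
Require Import Defs.
From mathcomp Require Import all_boot all_order all_algebra.
From mathcomp Require Import reals complex.

(* Write R_h for y |-> [y,h].  If [L,L] lies in the nilradical U, odd elements
   lie in U, since R_x^2 = R_[x,x]/2.  The even part acts on U/[U,U] by commuting
   operators with dim U/[U,U] weights; an even element killed by all weights acts
   nilpotently on U/[U,U], hence on U, hence lies in U.  So the weights embed L/U
   in K^n with n = dim U/[U,U], and dim L/U <= n for every competitor.

   If dim L/U = n the weights take arbitrary values.  An even h0 with all weights
   1 acts on U with eigenvalues >= 1, so its centralizer H is an abelian even
   complement of U.  An h in H with weight 1 at j and 2 elsewhere has 1 as a
   simple eigenvalue on U, which gives common eigenvectors of H generating U.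
   Hence H acts diagonalizably, and L is U + H with H a torus of rank n, maximal
   by the bound above applied to torus extensions.  Invertibility of h0 on U also
   makes the condition on brackets of odd elements automatic, so that U extended
   by any torus of rank n is a competitor. *)

Set Implicit Arguments.
Unset Strict Implicit.
Unset Printing Implicit Defensive.

Import Order.TTheory GRing.Theory Num.Theory passmx.
Local Open Scope ring_scope.

(** * Graded subspaces and the lower central series *)

Section GradedTheory.
Variables (K : fieldType) (L : lieSuperalgType K).
Implicit Types (x y z h : L) (U V X Y Z : {vspace L}) (i j : bool).

Lemma graded_ind U (P : L -> Prop) :
  graded_subspace U -> (forall x y, P x -> P y -> P (x + y)) ->
  (forall i x, x \in U -> x \in grade i -> P x) -> forall x, x \in U -> P x.
Proof.
move=> gU PD PU x; rewrite gU => /memv_addP[x0 + [x1 + ->]].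
rewrite !memv_cap => /andP[U0 g0] /andP[U1 g1].
by apply: PD; [apply: (PU false) | apply: (PU true)].
Qed.

Lemma graded_subspaceP U : graded_subspace U <->
  forall x, x \in U -> exists2 x0 : L, x0 \in U /\ x0 \in grade false &
    exists2 x1 : L, x1 \in U /\ x1 \in grade true & x = x0 + x1.
Proof.
split=> [gU x|h].
  rewrite {1}gU => /memv_addP[x0 /memv_capP[? ?] [x1 /memv_capP[? ?] ->]].
  by exists x0 => //; exists x1.
apply/eqP; rewrite eqEsubv; apply/andP; split; last first.
  by apply/subvP => x /memv_addP[a /memv_capP[aU _]] [b /memv_capP[bU _] ->];
    rewrite memvD.
apply/subvP => x /h[x0 [x0U x0g] [x1 [x1U x1g] ->]].
by rewrite memv_add // memv_cap ?x0U ?x1U.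
Qed.

Lemma graded_fullv : graded_subspace {:L}.
Proof. by rewrite /graded_subspace !capfv grade_full. Qed.

Lemma grade_eq0 x : x \in grade false -> x \in grade true -> x = 0.
Proof.
move=> x0 x1; apply/eqP; rewrite -memv0 -grade_direct.
exact/memv_capP.
Qed.

Lemma grade_dec x : exists2 x0 : L, x0 \in grade false &
  exists2 x1 : L, x1 \in grade true & x = x0 + x1.
Proof.
have: x \in (grade false + grade true : {vspace L})%VS by rewrite grade_full memvf.
by case/memv_addP => x0 ? [x1 ? ->]; exists x0 => //; exists x1.
Qed.

Lemma brs_mono X X' Y Y' : (X <= X')%VS -> (Y <= Y')%VS ->
  (brs X Y <= brs X' Y')%VS.
Proof.
move=> /subvP sX /subvP sY; apply/brsP => x y /sX xX /sY yY; exact: memv_brs.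
Qed.

(** The signs of skew-symmetry and of the Jacobi identity make sense only for homogeneous elements;
    gradedness lets an inclusion of brackets be checked on these. *)
Lemma brs_graded_sub X Y Z : graded_subspace X -> graded_subspace Y ->
  (forall i j x y, x \in X -> x \in grade i -> y \in Y -> y \in grade j ->
     bra x y \in Z) ->
  (brs X Y <= Z)%VS.
Proof.
move=> gX gY h; apply/brsP => x y xX.
move: x xX y; apply: (graded_ind gX) => [x x' Px Px' y yY|i x xX xi].
  by rewrite braDl memvD ?Px ?Px'.
by apply: (graded_ind gY) => [y y' ? ?|j y yY yj]; rewrite ?braDr ?memvD ?(h i j).
Qed.

Lemma brs_comm X Y : graded_subspace X -> graded_subspace Y ->
  (brs X Y <= brs Y X)%VS.
Proof.
move=> gX gY; apply: brs_graded_sub => // i j x y xX xi yY yj.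
by rewrite (bra_skew _ _ _ _ xi yj) memvN memvZ // memv_brs.
Qed.

Lemma brs_graded X Y : graded_subspace X -> graded_subspace Y ->
  graded_subspace (brs X Y).
Proof.
move=> gX gY; apply/eqP; rewrite eqEsubv; apply/andP; split; last first.
  by rewrite subv_add !capvSl.
apply: brs_graded_sub => // i j x y xX xi yY yj.
have := bra_grade _ _ _ _ xi yj; have := memv_brs xX yY.
case: (i (+) j) => bXY bg.
  by apply: (subvP (addvSr _ _)); rewrite memv_cap bXY.
by apply: (subvP (addvSl _ _)); rewrite memv_cap bXY.
Qed.

Lemma lower_central_graded U m :
  graded_subspace U -> graded_subspace (lower_central U m).
Proof. by move=> gU; elim: m => //= m IH; apply: brs_graded. Qed.

(* [[x,y],z] = [x,[y,z]] - (-1)^(ij) [y,[x,z]] *)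
Lemma lower_central_ideal U m : graded_ideal U ->
  (brs (lower_central U m) fullv <= lower_central U m)%VS.
Proof.
move=> [gU /brsP idU]; elim: m => [|m /brsP IH] /=; first exact/brsP.
have gl := @lower_central_graded U m gU.
apply/brsP => w z; move: w.
suff h i z' : z' \in grade i -> forall w, w \in brs (lower_central U m) U ->
    bra w z' \in brs (lower_central U m) U.
  move=> w wU _; have [z0 /h h0 [z1 /h h1 ->]] := grade_dec z.
  by rewrite braDr memvD ?h0 ?h1.
(* Being mapped into a subspace by [brar z'] is membership in a preimage, which is again a subspace,
   so it may be checked on brackets of homogeneous elements. *)
move=> zi w wU; rewrite -[bra w z']/(brar z' w) -(lfunE (brar z')) memv_preim.
apply: subvP wU; apply: brs_graded_sub => // j k x y xX xj yU yk.
rewrite -memv_preim lfunE /= /brar.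
have := bra_jacobi _ _ _ _ _ _ xj yk zi.
move/(congr1 (fun v => v - (-1) ^+ (j && k) *: bra y (bra x z'))).
rewrite addrK => <-; apply: memvB.
  by apply: memv_brs => //; apply: idU; rewrite ?memvf.
apply: memvZ; have xz := bra_grade _ _ _ _ xj zi.
by rewrite (bra_skew _ _ _ _ yk xz) memvN memvZ // memv_brs // IH ?memvf.
Qed.

Lemma lower_central_sub U m : graded_ideal U -> (lower_central U m <= U)%VS.
Proof.
move=> iU; elim: m => //= m IH; apply: subv_trans IH.
by apply: subv_trans (lower_central_ideal m iU); apply: brs_mono; rewrite ?subvf.
Qed.

(** The series brackets with [U] on the right; skew-symmetry supplies the left version. *)
Lemma lower_central_lsub U m : graded_ideal U ->
  (brs U (lower_central U m) <= lower_central U m.+1)%VS.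
Proof.
by move=> [gU _]; apply: brs_comm => //; apply: lower_central_graded.
Qed.

(** An even element produces no sign, whatever the parity of the components of [y]. *)
Lemma bra_skew_even h y : h \in grade false -> bra h y = - bra y h.
Proof.
move=> h0; have [y0 Y0 [y1 Y1 ->]] := grade_dec y.
rewrite braDl braDr (bra_skew _ _ _ _ h0 Y0) (bra_skew _ _ _ _ h0 Y1).
by rewrite !scale1r opprD.
Qed.

(** This is the Jacobi identity for h, x, y, without signs since h is even; moving h to the right
    negates all three terms. *)
Lemma brar_derivation h x y : h \in grade false ->
  bra (bra x y) h = bra (bra x h) y + bra x (bra y h).
Proof.
move=> h0.
suff D i x' : x' \in grade i -> forall y, 
    bra (bra x' y) h = bra (bra x' h) y + bra x' (bra y h).
  have [x0 /D D0 [x1 /D D1 ->]] := grade_dec x.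
  by rewrite !braDl D0 D1 addrACA.
move=> xi {}y; have [y0 Y0 [y1 Y1 ->]] := grade_dec y.
rewrite !(braDr, braDl) addrACA; congr (_ + _).
  have:= bra_jacobi _ _ _ _ _ _ h0 xi Y0.
  rewrite !(bra_skew_even _ h0) /= scale1r braNl braNr => /(congr1 -%R).
  by rewrite opprD !opprK.
have:= bra_jacobi _ _ _ _ _ _ h0 xi Y1.
rewrite !(bra_skew_even _ h0) /= scale1r braNl braNr => /(congr1 -%R).
by rewrite opprD !opprK.
Qed.

(** For y of parity i, Jacobi gives [[y,x],x] + (-1)^i [x,[y,x]], and skew-symmetry turns [x,[y,x]]
    into (-1)^i [[y,x],x], so the two terms agree. *)
Lemma bra_sqr_odd x y : x \in grade true ->
  bra y (bra x x) = bra (bra y x) x *+ 2.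
Proof.
move=> x1.
suff D i y' : y' \in grade i -> bra y' (bra x x) = bra (bra y' x) x *+ 2.
  have [y0 /D D0 [y1 /D D1 ->]] := grade_dec y.
  by rewrite !braDl D0 D1 mulrnDl.
move=> yi; rewrite (bra_jacobi _ _ _ _ _ _ yi x1 x1) mulr2n; congr (_ + _).
rewrite (bra_skew _ _ _ _ x1 (bra_grade _ _ _ _ yi x1)).
by case: i {yi} => /=; rewrite ?expr0 ?expr1 ?scaleN1r ?scale1r ?opprK.
Qed.

End GradedTheory.

(** * Spectra of right multiplications *)

Section Spectrum.
Variables (K : fieldType) (L : lieSuperalgType K).
Implicit Types (x y z h v : L) (U V X Y Z : {vspace L}) (S : K -> Prop).

(** This is p(R_x) for the monic polynomial p with list of roots [s]; keeping the list makes
    induction on the roots possible. *)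
Fixpoint rshift x (s : seq K) : 'End(L) :=
  if s is c :: s' then (rshift x s' \o (linfun (brar x) - c *: \1))%VF else \1%VF.

Lemma rshift_nil x v : rshift x [::] v = v.
Proof. by rewrite lfunE. Qed.

Lemma rshift_cons x c s v : rshift x (c :: s) v = rshift x s (bra v x - c *: v).
Proof. by rewrite /= comp_lfunE add_lfunE opp_lfunE scale_lfunE id_lfunE lfunE. Qed.

Definition rshiftE := (rshift_nil, rshift_cons).

Lemma rshift_cat x s t v : rshift x (s ++ t) v = rshift x t (rshift x s v).
Proof. by elim: s v => [|c s IH] v; rewrite ?cat0s ?rshift_nil // cat_cons !rshift_cons IH. Qed.

(** Both operators are polynomials in the same R_x. *)
Lemma rshift_comm x s t v :
  rshift x s (rshift x t v) = rshift x t (rshift x s v).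
Proof.
have step c d w : rshift x [:: c] (rshift x [:: d] w) = rshift x [:: d] (rshift x [:: c] w).
  rewrite !rshiftE !(braDl, braNl, braZl, scalerDr, scalerN) !scalerA.
  by rewrite (mulrC c) !opprD !opprK !addrA; congr (_ + _); rewrite addrAC.
have step1 c w : rshift x s (rshift x [:: c] w) = rshift x [:: c] (rshift x s w).
  elim: s w => [|d s IH] w; first by rewrite !rshift_nil.
  by rewrite -[d :: s]/([:: d] ++ s) !rshift_cat step IH.
elim: t v => [|d t IH] v; first by rewrite !rshift_nil.
by rewrite -[d :: t]/([:: d] ++ t) !rshift_cat IH step1.
Qed.

Lemma rshift_mem x s X v : (forall w, w \in X -> bra w x \in X) -> v \in X ->
  rshift x s v \in X.
Proof.
move=> sX; elim: s v => [|c s IH] v vX; rewrite !rshiftE //.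
by apply: IH; rewrite memvB ?memvZ ?sX.
Qed.

Lemma rshift_eigen x c s v : bra v x = c *: v ->
  rshift x s v = (\prod_(a <- s) (c - a)) *: v.
Proof.
move=> vc; elim: s => [|a s IH]; first by rewrite big_nil scale1r rshift_nil.
by rewrite rshift_cons big_cons vc -scalerBl linearZ /= IH scalerA.
Qed.

(* The eigenvalues of [v |-> [v,x]] on the image of [X] modulo [X'] lie in [S]. *)
Definition rspec S x X X' : Prop :=
  exists2 s : seq K, forall c, c \in s -> S c &
    forall v, v \in X -> rshift x s v \in X'.

Lemma rspec_trans S x X X' X'' : rspec S x X X' -> rspec S x X' X'' ->
  rspec S x X X''.
Proof.
move=> [s sS hs] [t tS ht]; exists (s ++ t).
  by move=> c; rewrite mem_cat => /orP[/sS|/tS].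
by move=> v /hs/ht; rewrite rshift_cat.
Qed.

Lemma rspec_mono S x X X' Y Y' : (Y <= X)%VS -> (X' <= Y')%VS ->
  rspec S x X X' -> rspec S x Y Y'.
Proof.
by move=> /subvP sYX /subvP sXY [s sS hs]; exists s => // v /sYX/hs/sXY.
Qed.

(** The shifts multiply [v] by the product of the c - a over roots a in [S], a nonzero scalar
    because c is not in [S]. *)
Lemma rspec_eigen S x X X' v c : rspec S x X X' -> v \in X ->
  bra v x = c *: v -> ~ S c -> v \in X'.
Proof.
move=> [s sS hs] /hs + vc nS; rewrite (rshift_eigen _ vc).
suff p0 : \prod_(a <- s) (c - a) != 0.
  by move/(memvZ (\prod_(a <- s) (c - a))^-1); rewrite scalerA mulVf // scale1r.
rewrite prodf_seq_neq0; apply/allP => a /sS Sa; rewrite subr_eq0.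
by apply/eqP => ca; apply: nS; rewrite ca.
Qed.

(* [(R-a-b)[x,y] = [(R-a)x,y] + [x,(R-b)y]] for the derivation [R = R_h] *)
Lemma rshift_bra h (s t : seq K) X Y X' Y' Z : h \in grade false ->
  (forall w, w \in X -> bra w h \in X) -> (forall w, w \in Y -> bra w h \in Y) ->
  (forall w, w \in Z -> bra w h \in Z) ->
  (brs X' Y <= Z)%VS -> (brs X Y' <= Z)%VS ->
  exists2 r : seq K,
    forall c, c \in r -> exists a b, [/\ a \in s, b \in t & c = a + b] &
    forall x y, x \in X -> y \in Y -> rshift h s x \in X' ->
      rshift h t y \in Y' -> rshift h r (bra x y) \in Z.
Proof.
move=> h0 sX sY sZ /brsP X'Y /brsP XY'.
elim: s t => [|a s IHs] t.
  by exists [::] => // x y xX yY xX' _; rewrite !rshift_nil in xX' *; apply: X'Y.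
elim: t => [|b t [r2 r2in IH2]].
  by exists [::] => // x y xX yY _ yY'; rewrite !rshift_nil in yY' *; apply: XY'.
have [r1 r1in IH1] := IHs (b :: t).
(* After one shift by a + b, [x,y] becomes two brackets. [r1] handles the one where x has lost the
   root a, [r2] the one where y has lost b; since shifts commute, the concatenation handles both. *)
exists ((a + b) :: r1 ++ r2).
  move=> c; rewrite inE mem_cat => /orP[/eqP->|/orP[/r1in|/r2in]].
  - by exists a, b; rewrite !mem_head.
  - by move=> [a' [b' [a's b't ->]]]; exists a', b'; rewrite inE a's orbT.
  - by move=> [a' [b' [a's b't ->]]]; exists a', b'; split=> //; rewrite inE b't orbT.
move=> x y xX yY xs yt; rewrite rshift_cons.
have -> : bra (bra x y) h - (a + b) *: bra x y =
    bra (bra x h - a *: x) y + bra x (bra y h - b *: y).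
  rewrite brar_derivation // braDl braNl braZl braDr braNr braZr.
  by rewrite scalerDl opprD addrACA.
rewrite linearD /=; apply: memvD; rewrite rshift_cat.
  apply: rshift_mem => //; apply: IH1 => //; first by rewrite memvB ?memvZ ?sX.
  by move: xs; rewrite rshift_cons.
rewrite rshift_comm; apply: rshift_mem => //; apply: IH2 => //.
  by rewrite memvB ?memvZ ?sY.
by move: yt; rewrite rshift_cons.
Qed.

Lemma rspec_brs S S' S'' h X Y X' Y' Z : h \in grade false ->
  (forall w, w \in X -> bra w h \in X) -> (forall w, w \in Y -> bra w h \in Y) ->
  (forall w, w \in Z -> bra w h \in Z) ->
  (brs X' Y <= Z)%VS -> (brs X Y' <= Z)%VS ->
  (forall a b, S a -> S' b -> S'' (a + b)) ->
  rspec S h X X' -> rspec S' h Y Y' -> rspec S'' h (brs X Y) Z.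
Proof.
move=> h0 sX sY sZ X'Y XY' SS [s sS hs] [t tS ht].
have [r rin hr] := rshift_bra s t h0 sX sY sZ X'Y XY'.
exists r; first by move=> c /rin[a [b [/sS Sa /tS Sb ->]]]; apply: SS.
move=> v vXY; rewrite memv_preim; apply: subvP vXY; apply/brsP => x y xX yY.
by rewrite -memv_preim hr ?hs ?ht.
Qed.

Lemma lower_central_stable U m x w : graded_ideal U ->
  w \in lower_central U m -> bra w x \in lower_central U m.
Proof. by move=> /(lower_central_ideal m)/brsP iU wU; apply: iU; rewrite ?memvf. Qed.

(** Eigenvalues on brackets are sums of eigenvalues, so a set closed under sums that contains those
    on U/[U,U] contains them all. [S2] records that at least two summands occur on [U,U]; this later
    separates the eigenvalue 1 from those on [U,U]. *)
Lemma rspec_lower_central S S2 h U m : h \in grade false -> graded_ideal U ->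
  (forall a b, S a -> S b -> S (a + b)) ->
  (forall a b, S a -> S b -> S2 (a + b)) ->
  rspec S h U (brs U U) ->
  rspec S h U (lower_central U m.+1) /\
  rspec S2 h (brs U U) (lower_central U m.+2).
Proof.
move=> h0 iU SS SS2 hU.
have step S' k : (forall a b, S a -> S b -> S' (a + b)) ->
    rspec S h U (lower_central U k.+1) ->
    rspec S' h (brs U U) (lower_central U k.+2).
  move=> SS' hk; have st j w := @lower_central_stable U j h w iU.
  by apply: (rspec_brs h0 _ _ _ _ _ SS' hk hk) => //;
     [exact: (st 0) | exact: (st 0) | exact: st | exact: lower_central_lsub].
suff hm : rspec S h U (lower_central U m.+1) by split; last exact: step.
elim: m => [|m /(step S) IH] //; exact: rspec_trans hU (IH _).
Qed.

Lemma rspec_nilpotent S S2 h U : h \in grade false -> graded_ideal U ->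
  nilpotent_lsa U ->
  (forall a b, S a -> S b -> S (a + b)) ->
  (forall a b, S a -> S b -> S2 (a + b)) ->
  rspec S h U (brs U U) -> rspec S h U 0%VS /\ rspec S2 h (brs U U) 0%VS.
Proof.
move=> h0 iU [m Um] SS SS2 hU.
(* The series stays zero from [m] on, so the shifted indices of [rspec_lower_central] are
   harmless. *)
have le k : (k >= m)%N -> (lower_central U k <= 0)%VS.
  move/subnKC <-; elim: (k - m)%N => [|j IH]; first by rewrite addn0 Um.
  rewrite addnS /=; apply/brsP => x y /(subvP IH); rewrite memv0 => /eqP-> _.
  by rewrite bra0l mem0v.
have [h1 h2] := rspec_lower_central m h0 iU SS SS2 hU.
by split; [apply: rspec_mono h1 | apply: rspec_mono h2]; rewrite ?subvv ?le //;
  exact: leqW.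
Qed.

(** Any subspace containing [L,L] is an ideal, and a homogeneous line keeps it graded. *)
Lemma graded_ideal_add_line i x U : graded_ideal U ->
  (brs {:L} {:L} <= U)%VS -> x \in grade i -> graded_ideal (U + <[x]>)%VS.
Proof.
move=> [gU _] LU xi; split; last first.
  by apply: subv_trans (addvSl _ _); apply: subv_trans LU; rewrite brs_mono ?subvf.
apply/eqP; rewrite eqEsubv; apply/andP; split; last by rewrite subv_add !capvSl.
rewrite subv_add; apply/andP; split.
  by rewrite {1}gU; apply: addvS; apply: capvS; rewrite // addvSl.
have xc : (<[x]> <= (U + <[x]>) :&: grade i)%VS.
  by rewrite subv_cap addvSr -memvE.
by case: i {xi} xc => xc; apply: subv_trans xc _; rewrite ?addvSl ?addvSr.
Qed.

(** An Engel-type argument: by induction on m, the lower central series of U + Kx eventually enters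
    the m-th term of that of U. *)
Lemma nilpotent_add_line U x : graded_ideal U -> nilpotent_lsa U ->
  (brs {:L} {:L} <= U)%VS -> rspec (fun c => c = 0) x U 0%VS ->
  nilpotent_lsa (U + <[x]>)%VS.
Proof.
move=> iU [n Un] LU [s s0 hs]; set I := (U + <[x]>)%VS.
suff [j hj] : exists j, (lower_central I j <= lower_central U n)%VS.
  by exists j; apply/eqP; rewrite -subv0 -Un.
elim: n {Un} => [|m [j IH]].
  by exists 1%N; apply: subv_trans LU; rewrite brs_mono ?subvf.
(* Inside the m-th term, bracketing with U lands in the next term, while bracketing with x adds one
   factor R_x. Hence t more brackets with [I] lead into [W t]. *)
pose W t := (lower_central U m.+1 + rshift x (nseq t 0) @: lower_central U m)%VS.
have hW t : (lower_central I (j + t) <= W t)%VS.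
  elim: t => [|t IHt].
    rewrite addn0; apply/subvP => v /(subvP IH) vU.
    by apply: (subvP (addvSr _ _)); rewrite -[v](rshift_nil x) memv_img.
  rewrite addnS /=; apply: subv_trans (brs_mono IHt (subvv _)) _.
  apply/brsP => _ y /memv_addP[a aU [_ /memv_imgP[b bU ->] ->]].
  move=> /memv_addP[u uU [_ /vlineP[c ->] ->]] {y}.
  have a'U : a \in lower_central U m.
    by apply: (subvP _ _ aU); rewrite /=; apply: subv_trans (lower_central_ideal m iU);
      rewrite brs_mono ?subvf.
  have wU := rshift_mem (nseq t 0) (fun w => @lower_central_stable U m x w iU) bU.
  rewrite braDr braZr addrC braDl; set w := rshift _ _ _ in wU *.
  have -> : bra w x = rshift x (nseq t.+1 0) b.
    by rewrite -addn1 nseqD rshift_cat !rshiftE scale0r subr0.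
  rewrite scalerDr addrAC; apply: memv_add; last by rewrite memvZ // memv_img.
  rewrite memvD ?memvZ //; first exact: (@lower_central_stable U m.+1).
  by rewrite memv_brs // memvD.
exists (j + size s)%N; apply: subv_trans (hW _) _; rewrite subv_add subvv /=.
apply/subvP => _ /memv_imgP[b bU ->].
(* All roots in [s] are 0, so [rshift x s] is a power of R_x, and it kills U. *)
have -> : nseq (size s) 0 = s.
  by apply/esym/all_pred1P/allP => c /s0 /= ->.
have := hs _ (subvP (lower_central_sub m iU) _ bU); rewrite memv0 => /eqP->.
exact: mem0v.
Qed.

(** U + Kx is a nilpotent graded ideal, hence contained in the nilradical. *)
Lemma nilradical_ad_nilpotent i x U : is_nilradical U ->
  (brs {:L} {:L} <= U)%VS -> x \in grade i -> rspec (fun c => c = 0) x U 0%VS ->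
  x \in U.
Proof.
move=> [iU nU maxU] LU xi hx; apply: subvP (memv_line x).
apply: subv_trans (addvSr U _) (maxU _ _ _).
  exact: graded_ideal_add_line xi.
exact: nilpotent_add_line.
Qed.

End Spectrum.

(** * Weights on the abelianization of the nilradical *)

(** The quotient of U by its intersection with W is modelled by the complement [C] of W in U. The
    operators compressed to [C] by the projection [P] commute, so they have a common eigenvector
    over a closed field. *)
Lemma common_eigenvector_mod (K : numClosedFieldType) (E : vectType K)
    (s : seq 'End(E)) (U W : {vspace E}) :
  ~~ (U <= W)%VS ->
  (forall a, a \in s -> forall u, u \in U -> a u \in U) ->
  (forall a, a \in s -> forall u, u \in W -> a u \in W) ->
  (forall a b, a \in s -> b \in s -> forall u, u \in U ->
     a (b u) - b (a u) \in W) ->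
  exists v, [/\ v \in U, v \notin W &
    forall a, a \in s -> exists c, a v - c *: v \in W].
Proof.
move=> UW sU sW sUW; set C := (U :\: W)%VS; pose P := addv_pi1 U W.
have PC u : P u \in C by apply: memv_pi.
have CU : (C <= U)%VS by apply: diffvSl.
have CW : (C :&: W = 0)%VS.
  by apply/eqP; rewrite -subv0 capv_diff.
have P_id u : u \in C -> P u = u by apply: daddv_pi_id.
have PW u : u \in W -> P u = 0.
  move=> uW; have uV : u \in (C + W)%VS by apply: (subvP (addvSr _ _)).
  have := daddv_pi_add CW uV; rewrite (daddv_pi_id _ uW) ?[(W :&: _)%VS]capvC //.
  by move/(canRL (addrK _)); rewrite subrr.
have PuW u : u \in U -> u - P u \in W.
  move=> uU; have uV : u \in (C + W)%VS.
    by rewrite addv_diff; apply: (subvP (addvSl _ _)).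
  by rewrite -{1}(daddv_pi_add CW uV) addrC addKr memv_pi.
pose g (a : 'End(E)) : 'End(subvs_of C) := linfun (vsproj C \o P \o a \o vsval).
have gE a x : vsval (g a x) = P (a (vsval x)).
  by rewrite lfunE /= vsprojK.
have C0 : (0 < \dim {:subvs_of C})%N.
  rewrite dimvf /dim /= lt0n dimv_eq0; apply/eqP => C00.
  by case/negP: UW; rewrite -diffv_eq0 -/C C00.
have eb := vbasisP {:subvs_of C}; set e := vbasis _ in eb.
have [a b|v v0 /allP stv] :=
    common_eigenvector (As := [seq mxof e e (g a) | a <- s]) C0.
  move=> /mapP[a' a's ->] /mapP[b' b's ->]; rewrite /comm_mx -!mxof_comp //.
  congr (mxof _ _ _); apply/lfunP => x; rewrite !comp_lfunE; apply: val_inj => /=.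
  rewrite !gE; apply/eqP; rewrite -subr_eq0 -!raddfB /=; apply/eqP.
  have xU : vsval x \in U by apply: (subvP CU); apply: subvsP.
  have h c d : c \in s -> d \in s -> c (P (d (vsval x))) - c (d (vsval x)) \in W.
    by move=> as_ bs; rewrite -raddfB /= -opprB raddfN memvN; apply: sW => //;
      apply: PuW; apply: sU.
  (* Each product of compressions agrees with the product of the original operators modulo W, and
     the latter commute modulo W. *)
  have split4 (p q r t : E) : p - q = (p - r) + (r - t) - (q - t).
    by rewrite [p - r + _]addrA subrK opprB addrA subrK.
  apply: PW; rewrite (split4 _ _ (b' (a' (vsval x))) (a' (b' (vsval x)))).
  by apply: memvB; [apply: memvD; [exact: h | exact: sUW] | exact: h].
exists (vsval (vecof e v)).
have ve0 : vecof e v != 0.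
  by apply: contra v0 => /eqP v0; rewrite -(vecofK eb v) v0 linear0.
split.
- exact: subvP CU _ (subvsP _).
- apply: contra ve0 => vW; rewrite -(inj_eq val_inj) /= -memv0 -CW memv_cap.
  by rewrite subvsP.
move=> a as_; have /stv/sub_rVP[c vc]: mxof e e (g a) \in [seq mxof e e (g a) | a <- s].
  exact: map_f.
exists c; have : g a (vecof e v) = c *: vecof e v by rewrite (hom_vecof _ eb) vc linearZ.
move/(congr1 vsval); rewrite gE linearZ /= => <-; apply: PuW.
by apply: sU => //; apply: (subvP CU); apply: subvsP.
Qed.

Section Weights.
Variables (K : numClosedFieldType) (L : lieSuperalgType K).
Implicit Types (x y z h v : L) (U V X Y Z : {vspace L}) (S : K -> Prop).

(* [wt h 0 i] is the eigenvalue of [v |-> [v,h]] on the line [W i.+1 / W i]. *)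
Definition weight_flag U n (W : nat -> {vspace L}) (w : 'I_n -> L)
    (wt : 'Hom(L, 'rV[K]_n)) : Prop :=
  [/\ W 0%N = brs U U /\ W n = U, forall i : 'I_n, W i.+1 = (W i + <[w i]>)%VS,
      forall i, w i \notin W i,
      forall i h, h \in grade false -> bra (w i) h - wt h 0 i *: w i \in W i &
      forall h, h \in U -> wt h = 0].

Lemma weight_flag_seq U k : graded_ideal U -> (brs {:L} {:L} <= U)%VS ->
  (k <= \dim U - \dim (brs U U))%N ->
  exists2 w : seq L, size w = k & forall i, (i < k)%N ->
    [/\ w`_i \in U, w`_i \notin (brs U U + <<take i w>>)%VS &
      forall h, h \in grade false -> exists c,
        bra w`_i h - c *: w`_i \in (brs U U + <<take i w>>)%VS].
Proof.
move=> iU LU; have UU : (brs U U <= U)%VS := lower_central_sub 1 iU.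
elim: k => [|k IH] kn; first by exists [::].
have [w sw hw] := IH (ltnW kn).
pose W i := (brs U U + <<take i w>>)%VS.
have sW h i : h \in grade false -> (i <= k)%N -> forall v, v \in W i -> bra v h \in W i.
  move=> h0; elim: i => [|i IHi] ik v.
    rewrite /W take0 span_nil addv0 => /(@lower_central_stable _ _ U 1 h v iU); exact.
  have iw : (i < size w)%N by rewrite sw.
  have -> : W i.+1 = (W i + <[w`_i]>)%VS.
    by rewrite /W (take_nth 0) // -cats1 span_cat span_seq1 addvA.
  move=> /memv_addP[a aW [_ /vlineP[c ->] ->]]; rewrite braDl braZl.
  have [_ _ /(_ _ h0)[d hd]] := hw _ ik.
  rewrite -(subrK (d *: w`_i) (bra w`_i h)) scalerDr addrA memv_add //.
    by rewrite memvD ?IHi ?memvZ // ltnW.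
  by rewrite !memvZ ?memv_line.
have WU : ~~ (U <= W k)%VS.
  have dW : (\dim (W k) <= \dim (brs U U) + k)%N.
    apply: leq_trans (dimv_add_leqif _ _) _; rewrite leq_add2l.
    by apply: leq_trans (dim_span _) _; rewrite size_take sw ltnn.
  apply/negP => /dimvS; rewrite leqNgt => /negP[].
  by apply: leq_ltn_trans dW _; rewrite -ltn_subRL.
(* A basis of the even part gives the finite list of operators required; the eigenvector property
   extends to every even element by linearity. *)
pose s := [seq (linfun (brar h) : 'End(L)) | h <- vbasis (grade false : {vspace L})].
have sin a : a \in s -> exists2 h, h \in grade false & forall v, a v = bra v h.
  by move=> /mapP[h /vbasis_mem hg ->]; exists h => // v; rewrite lfunE.
have [a as_ u uU|a /sin[h h0 ah] u uW|a b /sin[h h0 ah] /sin[h' h0' bh'] u uU|] :=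
    @common_eigenvector_mod _ _ s U (W k) WU.
- by have [h h0 ->] := sin a as_; apply: (@lower_central_stable _ _ U 0).
- by rewrite ah sW.
(* The commutator sends u to [u,[h',h]], which is in [U,U] because [h',h] is in U. *)
- rewrite !ah !bh'; apply: (subvP (addvSl _ _)).
  rewrite (brar_derivation u h' h0) addrC addKr.
  by rewrite memv_brs //; apply: subvP LU _ (memv_brs _ _); rewrite memvf.
move=> v [vU vW hv]; exists (rcons w v); first by rewrite size_rcons sw.
move=> i; pose W' i := (brs U U + <<take i (rcons w v)>>)%VS.
rewrite -/(W' i) ltnS leq_eqVlt => /orP[/eqP->|ik].
  have -> : W' k = W k by rewrite /W' /W -cats1 takel_cat ?sw.
  rewrite nth_rcons sw ltnn eqxx; split=> // h h0.
  have hb j : exists c, bra v (vbasis (grade false))`_j - c *: v \in W k.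
    have [jl|jl] := ltnP j (size (vbasis (grade false : {vspace L}))).
      have [|c] := hv (linfun (brar (vbasis (grade false))`_j)).
        by apply: map_f; apply: mem_nth.
      by rewrite lfunE; exists c.
    by exists 0; rewrite nth_default // bra0r scale0r subr0 mem0v.
  rewrite (coord_vbasis h0); elim/big_ind: _ => [|h1 h2 [c1 hc1] [c2 hc2]|j _].
  - by exists 0; rewrite bra0r scale0r subr0 mem0v.
  - by exists (c1 + c2); rewrite braDr scalerDl opprD addrACA memvD.
  - have [c hc] := hb j; exists (coord (vbasis (grade false)) j h * c).
    by rewrite braZr -scalerA -scalerBr memvZ.
have -> : W' i = W i by rewrite /W' /W -cats1 takel_cat ?sw // ltnW.
by rewrite nth_rcons sw ik; apply: hw.
Qed.

End Weights.

Lemma capv_line0 (K : fieldType) (E : vectType K) (w : E) (W : {vspace E}) :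
  w \notin W -> (W :&: <[w]> = 0)%VS.
Proof.
move=> wW; apply/eqP; rewrite -subv0.
apply/subvP => x /memv_capP[xW /vlineP[c xc]]; move: xW; rewrite xc.
have [->|c0] := eqVneq c 0; first by rewrite scale0r !mem0v.
by move=> /(memvZ c^-1); rewrite scalerA mulVf // scale1r (negPf wW).
Qed.

Lemma functional_mod (K : fieldType) (E : vectType K) (w : E) (W : {vspace E}) :
  w \notin W -> exists2 phi : 'Hom(E, K^o), phi w = 1 &
    forall z, z \in W -> phi z = 0.
Proof.
move=> wW; have w0 : w != 0 by apply: contraNneq wW => ->; rewrite mem0v.
have dw : (<[w]> :&: W = 0)%VS.
  by rewrite capvC capv_line0.
have fw : free [tuple w] by rewrite /= seq1_free.
pose cw : 'Hom(E, K^o) := linfun (coord [tuple w] ord0 : E -> K^o).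
exists (cw \o daddv_pi <[w]> W)%VF.
  rewrite comp_lfunE lfunE /= daddv_pi_id ?memv_line //.
  exact: (coord_free ord0 ord0 fw).
move=> z zW; rewrite comp_lfunE.
have zV : z \in (<[w]> + W)%VS by apply: (subvP (addvSr _ _)).
have := daddv_pi_add dw zV; rewrite (daddv_pi_id _ zW) ?[(W :&: _)%VS]capvC //.
by move/(canRL (addrK _)); rewrite subrr => ->; rewrite linear0.
Qed.

Section WeightFlag.
Variables (K : numClosedFieldType) (L : lieSuperalgType K).
Implicit Types (x y z h v : L) (U V X Y Z : {vspace L}) (S : K -> Prop).

(** The i-th weight is h |-> phi_i([w_i,h]), with phi_i a functional equal to 1 on w_i and vanishing
    on [W i]. This reads off the eigenvalue for even h and is linear in h by construction. *)
Lemma weight_flag_exists U : graded_ideal U -> (brs {:L} {:L} <= U)%VS ->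
  exists W w wt, @weight_flag _ L U (\dim U - \dim (brs U U)) W w wt.
Proof.
move=> iU LU; have UU : (brs U U <= U)%VS := lower_central_sub 1 iU.
have [s ss hs] := weight_flag_seq iU LU (leqnn _).
set n := (\dim U - \dim (brs U U))%N in ss hs *.
pose W i := (brs U U + <<take i s>>)%VS; pose w (i : 'I_n) := s`_i.
have hW (i : 'I_n) : W i.+1 = (W i + <[w i]>)%VS.
  by rewrite /W (take_nth 0) ?ss // -cats1 span_cat span_seq1 addvA.
have wW i : w i \notin W i by have [] := hs _ (ltn_ord i).
have WU i : (W i <= U)%VS.
  rewrite subv_add UU; apply/span_subvP => x /mem_take/(nthP 0)[j js <-].
  by rewrite ss in js; have [] := hs _ js.
have dW i : (i <= n)%N -> \dim (W i) = (\dim (brs U U) + i)%N.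
  elim: i => [|i IH] ik; first by rewrite /W take0 span_nil addv0 addn0.
  rewrite (hW (Ordinal ik)) dimv_disjoint_sum ?IH ?(ltnW ik) //.
    have -> : \dim <[w (Ordinal ik)]> = 1%N.
      rewrite dim_vline; case: eqP (wW (Ordinal ik)) => // ->.
      by rewrite mem0v.
    by rewrite addn1 addnS.
  exact: capv_line0.
have phi_ex i := functional_mod (wW i).
have [phi phiP] : exists phi : 'I_n -> 'Hom(L, K^o), forall i,
    phi i (w i) = 1 /\ forall z, z \in W i -> phi i z = 0.
  have : forall i, exists f : 'Hom(L, K^o), 
      f (w i) = 1 /\ forall z, z \in W i -> f z = 0.
    by move=> i; have [f] := phi_ex i; exists f.
  exact: fin_all_exists.
pose wt h : 'rV[K]_n := \row_i phi i (bra (w i) h).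
have wt_lin : linear wt.
  by move=> a x y; apply/rowP => i; rewrite !mxE braDr braZr linearP.
pose wtL := GRing.isLinear.Build _ _ _ _ wt wt_lin.
pose wtH : 'Hom(L, 'rV[K]_n) := linfun (HB.pack_for {linear L -> 'rV[K]_n} wt wtL).
exists W, w, wtH; split=> //.
- split; first by rewrite /W take0 span_nil addv0.
  by apply/eqP; rewrite eqEdim WU dW // subnKC // dimvS.
- move=> i h h0; rewrite lfunE /= mxE.
  have [_ _ /(_ _ h0)[c hc]] := hs _ (ltn_ord i); have [p1 p0] := phiP i.
  suff -> : phi i (bra (w i) h) = c by [].
  have /p0 : bra (w i) h - c *: w i \in W i by [].
  rewrite raddfB /= linearZ /= p1 => /eqP; rewrite subr_eq0 => /eqP->.
  exact: mulr1.
- move=> h hU; rewrite lfunE; apply/rowP => i; rewrite !mxE.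
  have [_ ->] := phiP i => //; apply: (subvP (addvSl _ _)).
  by rewrite memv_brs //; have [] := hs _ (ltn_ord i).
Qed.

Section Flag.
Variables (U : {vspace L}) (n : nat) (W : nat -> {vspace L}) (w : 'I_n -> L)
  (wt : 'Hom(L, 'rV[K]_n)).
Hypotheses (iU : graded_ideal U) (fW : weight_flag U W w wt).

Lemma weight_flag_mono i j : (i <= j <= n)%N -> (W i <= W j)%VS.
Proof.
have [_ hW _ _ _] := fW.
case/andP=> /subnKC <-; elim: (j - i)%N => [|k IH]; first by rewrite addn0.
rewrite addnS => lt; apply: subv_trans (IH (ltnW lt)) _.
by rewrite (hW (Ordinal lt)) addvSl.
Qed.

Lemma weight_flag_stable h i v : h \in grade false -> (i <= n)%N ->
  v \in W i -> bra v h \in W i.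
Proof.
have [[W0 _] hW _ wtP _] := fW.
move=> h0; elim: i v => [|i IH] v lt.
  rewrite W0 => vU; exact: (@lower_central_stable _ _ U 1).
rewrite (hW (Ordinal lt)) => /memv_addP[a aW [_ /vlineP[c ->] ->]].
have := wtP (Ordinal lt) h h0; set b := _ *: w _ => hb.
rewrite braDl braZl -(subrK b (bra (w _) h)) scalerDr addrA memv_add //.
  by rewrite memvD ?IH ?memvZ // ltnW.
by rewrite !memvZ ?memv_line.
Qed.

(** R_h is triangular along the flag with the weights on its diagonal; shifting by the weight at the
    top of the flag descends one step. *)
Lemma weight_flag_rspec S h i j : h \in grade false -> (i <= j <= n)%N ->
  (forall k : 'I_n, (i <= k < j)%N -> S (wt h 0 k)) -> rspec S h (W j) (W i).
Proof.
have [_ hW _ wtP _] := fW.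
move=> h0 /andP[ij]; move: ij => /subnKC <-.
elim: (j - i)%N => [|k IH] lt hS.
  by rewrite addn0; exists [::] => // v; rewrite rshift_nil.
rewrite addnS in lt hS *; apply: rspec_trans (IH (ltnW lt) _); last first.
  by move=> m /andP[im mk]; apply: hS; rewrite im ltnW.
pose o := Ordinal lt; exists [:: wt h 0 o].
  by move=> c; rewrite inE => /eqP->; apply: hS; rewrite /= leq_addr ltnSn.
move=> v; rewrite (hW o) => /memv_addP[a aW [_ /vlineP[c ->] ->]].
rewrite !rshiftE braDl scalerDr opprD addrACA memvD //.
  by rewrite memvB ?memvZ // weight_flag_stable // ltnW.
by rewrite braZl scalerA mulrC -scalerA -scalerBr memvZ // wtP.
Qed.

End Flag.
End WeightFlag.

(** * Structure of the extension *)

Section EigenGeneration.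
Variables (K : fieldType) (L : lieSuperalgType K).
Implicit Types (x y z h v : L) (U V X Y Z : {vspace L}).

Lemma bra_span (b b' : seq L) x y : x \in <<b>>%VS -> y \in <<b'>>%VS ->
  bra x y \in <<[seq bra u v | u <- b, v <- b']>>%VS.
Proof.
move=> xb yb; rewrite (coord_span (X := in_tuple b) xb) -/(brar y _) linear_sum.
apply: memv_suml => i _; rewrite linearZZ memvZ //= /brar.
rewrite (coord_span (X := in_tuple b') yb) linear_sum; apply: memv_suml => j _ /=.
rewrite linearZZ memvZ // memv_span //; apply/allpairsP.
by exists (b`_i, b'`_j); split=> //=; apply: mem_nth.
Qed.

(** R_h is a derivation, so brackets of eigenvectors are eigenvectors; by nilpotency, vectors
    spanning U modulo [U,U] generate U. *)
Lemma eigen_generation h U (b0 : seq L) : h \in grade false -> graded_ideal U ->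
  nilpotent_lsa U -> (U <= brs U U + <<b0>>)%VS -> (<<b0>> <= U)%VS ->
  (forall v, v \in b0 -> exists c, bra v h = c *: v) ->
  exists2 b : seq L, <<b>>%VS = U &
    forall v, v \in b -> exists c, bra v h = c *: v.
Proof.
move=> h0 iU [m Um] Ub0 b0U eb0.
suff [b bU [Ub eb]] : exists2 b : seq L, (<<b>> <= U)%VS &
    (U <= lower_central U m.+1 + <<b>>)%VS /\
    forall v, v \in b -> exists c, bra v h = c *: v.
  exists b => //; apply/eqP; rewrite eqEsubv bU; apply: subv_trans Ub _.
  rewrite subv_add subvv andbT /= Um; apply/brsP => x y.
  by rewrite memv0 => /eqP-> _; rewrite bra0l mem0v.
elim: m {Um} => [|m [b bU [Ub eb]]]; first by exists b0.
(* If [b] spans U modulo one term of the series, the brackets of its pairs span [U,U] modulo the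
   next term, and [b0] supplies the rest of U. *)
exists (b0 ++ [seq bra u v | u <- b, v <- b]).
  rewrite span_cat subv_add b0U; apply/span_subvP => _ /allpairsP[[u v] /= [ub vb ->]].
  apply: (subvP (lower_central_sub 1 iU)); rewrite /= memv_brs //.
    by apply: (subvP bU); apply: memv_span.
  by apply: (subvP bU); apply: memv_span.
split.
  rewrite span_cat [(<<b0>> + _)%VS]addvC addvA.
  apply: subv_trans Ub0 _; apply: addvS => //; apply/brsP => x y.
  move=> /(subvP Ub)/memv_addP[a aU [s sb ->]] yU.
  rewrite braDl addrC memvD //; last first.
    by apply: (subvP (addvSl _ _)); apply: memv_brs.
  move: yU => /(subvP Ub)/memv_addP[a' aU' [s' sb' ->]].
  rewrite braDr; apply: memv_add; last exact: bra_span.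
  apply: (subvP (lower_central_lsub m.+1 iU)); apply: memv_brs => //.
  exact: (subvP bU).
move=> v; rewrite mem_cat => /orP[/eb0 //|/allpairsP[[x y] /= [/eb[c xc] /eb[d yd] ->]]].
by exists (c + d); rewrite brar_derivation // xc yd braZl braZr scalerDl.
Qed.

End EigenGeneration.

(** * Weights of an extension and the centralizer of a grading element *)

Section MaximalNilradical.
Variables (K : numClosedFieldType) (L : lieSuperalgType K) (U : {vspace L}).
Implicit Types (x y z h v : L) (X Y Z : {vspace L}) (S : K -> Prop).
Hypotheses (nU : is_nilradical U) (LU : (brs {:L} {:L} <= U)%VS).

Let iU : graded_ideal U. Proof. by case: nU. Qed.
Let nilU : nilpotent_lsa U. Proof. by case: nU. Qed.
Let braU x y : bra x y \in U.
Proof. by apply: (subvP LU); rewrite memv_brs ?memvf. Qed.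

(* [R_x^2 = R_[x,x]/2] for odd [x], and [x,x] lies in [U]. *)
Lemma odd_sub_nilradical : (grade true <= U)%VS.
Proof.
apply/subvP => x x1; apply: (nilradical_ad_nilpotent nU LU x1).
have [m Um] := nilU; rewrite -Um; elim: m {Um} => [|m IH].
  by exists [::] => // v; rewrite rshift_nil.
apply: rspec_trans IH _; exists [:: 0; 0].
  by move=> c; rewrite !inE => /orP[]/eqP.
move=> v vU; rewrite !rshiftE !scale0r !subr0.
have : bra v (bra x x) \in lower_central U m.+1 by rewrite /= memv_brs.
rewrite bra_sqr_odd // -scaler_nat => /(memvZ (2%:R)^-1).
by rewrite scalerA mulVf ?scale1r // pnatr_eq0.
Qed.

Lemma even_representative h : exists2 h0, h0 \in grade false & h - h0 \in U.
Proof.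
have [h0 hg0 [h1 hg1 ->]] := grade_dec h; exists h0 => //.
by rewrite addrC addKr; apply: (subvP odd_sub_nilradical).
Qed.

Let n := (\dim U - \dim (brs U U))%N.
Variables (W : nat -> {vspace L}) (w : 'I_n -> L) (wt : 'Hom(L, 'rV[K]_n)).
Hypothesis fW : weight_flag U W w wt.

Lemma weight_representative h : exists2 h0, h0 \in grade false & wt h0 = wt h.
Proof.
have [h0 hg0 hU] := even_representative h; exists h0 => //.
have [_ _ _ _ /(_ _ hU)/eqP] := fW.
by rewrite linearB subr_eq0 => /eqP->.
Qed.

Lemma weight_rspec S h : h \in grade false -> (forall i, S (wt h 0 i)) ->
  rspec S h U (brs U U).
Proof.
move=> h0 hS; have [[<- <-] _ _ _ _] := fW.
by apply: (weight_flag_rspec iU fW) => //; rewrite leq0n leqnn.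
Qed.

(** Zero weights on U/[U,U] propagate to U as sums of zeros, so an even element with zero weights
    acts nilpotently on U and lies in the nilradical. Odd components are already in U. *)
Lemma lker_weight : lker wt = U.
Proof.
apply/eqP; rewrite eqEsubv; apply/andP; split; apply/subvP => h; last first.
  by have [_ _ _ _ wt0] := fW; rewrite memv_ker => /wt0->.
rewrite memv_ker => /eqP wth; have [h0 hg0 hU] := even_representative h.
rewrite -(subrK h0 h) memvD //; apply: (nilradical_ad_nilpotent nU LU hg0).
have wth0 : wt h0 = 0.
  have [_ _ _ _ /(_ _ hU)] := fW.
  by rewrite linearB /= wth sub0r => /eqP; rewrite oppr_eq0 => /eqP.
have [|||//] := @rspec_nilpotent _ _ (fun c : K => c = 0) (fun c => c = 0) h0 U hg0 iU nilU.
- by move=> a b -> ->; rewrite addr0.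
- by move=> a b -> ->; rewrite addr0.
by apply: weight_rspec => // i; rewrite wth0 mxE.
Qed.

Lemma dim_limg_weight : (\dim (limg wt) = codimv U)%N.
Proof. by rewrite /codimv -(limg_ker_dim wt) capfv lker_weight addKn. Qed.

Lemma codimv_nilradical_flag : (codimv U <= n)%N.
Proof.
by rewrite -dim_limg_weight; apply: leq_trans (dimvS (subvf _)) _; rewrite dimvf /dim /= mul1n.
Qed.

Hypothesis maxU : codimv U = n.

Lemma weight_surj (r : 'rV[K]_n) : exists2 h, h \in grade false & wt h = r.
Proof.
have /subvP/(_ r (memvf _))/memv_imgP[h _ ->] : (fullv <= limg wt)%VS.
  have /eqP -> // : limg wt == fullv.
  by rewrite eqEdim subvf dim_limg_weight maxU dimvf /dim /= mul1n.
by have [h0 ? <-] := weight_representative h; exists h0.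
Qed.

(** In the partial order of the field, [1 <= c] includes that c is real; sums of two such numbers
    are at least 2. *)
Lemma weight_rspec_ge1 h : h \in grade false -> (forall i, 1 <= wt h 0 i) ->
  rspec (fun c : K => 1 <= c) h U 0%VS /\
  rspec (fun c : K => 2 <= c) h (brs U U) 0%VS.
Proof.
move=> h0 h1; apply: rspec_nilpotent => //; last exact: weight_rspec.
- by move=> a b a1 b1; apply: le_trans a1 _; rewrite lerDl (le_trans ler01).
- by move=> a b; apply: lerD.
Qed.

(** Taking all weights equal to 1 yields an analogue of an Euler operator: its eigenvalues on U
    avoid 0, so it is invertible there. *)
Lemma grading_element : exists2 h, h \in grade false &
  rspec (fun c : K => 1 <= c) h U 0%VS.
Proof.
have [h h0 wh] := weight_surj (const_mx 1); exists h => //.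
by have [i|] := weight_rspec_ge1 h0; rewrite ?wh ?mxE.
Qed.

Lemma grading_element_inj h v : rspec (fun c : K => 1 <= c) h U 0%VS ->
  v \in U -> bra v h = 0 -> v = 0.
Proof.
move=> hU vU vh; apply/eqP; rewrite -memv0; apply: (rspec_eigen hU vU (c := 0)).
  by rewrite scale0r.
by rewrite ler10.
Qed.

(** A bracket of odd elements lies in the even part of U, on which R_h is bijective for the even
    grading element h; hence it has the form [v,h] with v even. *)
Lemma odd_brackets : (brs (grade true : {vspace L}) (grade true) <=
  brs (grade false) (grade false))%VS.
Proof.
have [h h0 hU] := grading_element.
pose f : 'End(L) := linfun (brar h); pose U0 := (U :&: grade false)%VS.
have fU0 : (f @: U0)%VS = U0.
  apply/eqP; rewrite eqEdim; apply/andP; split.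
    apply/subvP => _ /memv_imgP[v /memv_capP[vU v0] ->].
    by rewrite lfunE memv_cap /= /brar braU (bra_grade _ _ _ _ v0 h0).
  rewrite limg_dim_eq //; apply/eqP; rewrite -subv0; apply/subvP => v.
  rewrite !memv_cap memv_ker lfunE /= => /andP[/andP[vU _] /eqP vh].
  by rewrite (grading_element_inj hU vU vh) mem0v.
apply/brsP => x y x1 y1.
have : bra x y \in U0 by rewrite memv_cap braU (bra_grade _ _ _ _ x1 y1).
rewrite -fU0 => /memv_imgP[v /memv_capP[_ v0] ->]; rewrite lfunE.
exact: memv_brs.
Qed.

Section Centralizer.
Variable h0 : L.
Hypotheses (h00 : h0 \in grade false)
  (h0U : rspec (fun c : K => 1 <= c) h0 U 0%VS).
Let H : {vspace L} := lker (linfun (brar h0)).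

Lemma centralizerE x : (x \in H) = (bra x h0 == 0).
Proof. by rewrite memv_ker lfunE. Qed.

Lemma centralizer_cap : (H :&: U = 0)%VS.
Proof.
apply/eqP; rewrite -subv0; apply/subvP => v /memv_capP[].
rewrite centralizerE => /eqP vh vU.
by rewrite (grading_element_inj h0U vU vh) mem0v.
Qed.

(** R_h0 maps L into U, so by rank-nullity its kernel is large enough to complement U. *)
Lemma centralizer_add : (H + U = fullv)%VS.
Proof.
apply/eqP; rewrite eqEdim subvf dimv_disjoint_sum ?centralizer_cap //.
rewrite -(limg_ker_dim (linfun (brar h0)) fullv) capfv leq_add2l dimvS //.
by apply/subvP => _ /memv_imgP[v _ ->]; rewrite lfunE; apply: braU.
Qed.

(** The bracket lies in U and is killed by R_h0, which is injective on U. *)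
Lemma centralizer_abelian x y : x \in H -> y \in H -> bra x y = 0.
Proof.
rewrite !centralizerE => /eqP xh /eqP yh; apply: (grading_element_inj h0U) => //.
by rewrite brar_derivation // xh yh bra0l bra0r addr0.
Qed.

(** The brackets of the two components of x with h0 are opposite and of different parity, hence
    zero; the odd component lies in U, where R_h0 is injective. *)
Lemma centralizer_even : (H <= grade false)%VS.
Proof.
apply/subvP => x; rewrite centralizerE; have [x0 xg0 [x1 xg1 ->]] := grade_dec x.
rewrite braDl addr_eq0 => /eqP xh.
suff -> : x1 = 0 by rewrite addr0.
have x1h := bra_grade _ _ _ _ xg1 h00; have x0h := bra_grade _ _ _ _ xg0 h00.
apply: (grading_element_inj h0U); first exact: (subvP odd_sub_nilradical).
by apply: grade_eq0 x1h; rewrite -[bra x1 h0]opprK -xh memvN.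
Qed.

Lemma centralizer_representative h : exists2 h', h' \in H & wt h' = wt h.
Proof.
have : h \in (H + U)%VS by rewrite centralizer_add memvf.
case/memv_addP => h' h'H [u uU ->]; exists h' => //.
by have [_ _ _ _ wt0] := fW; rewrite linearD /= (wt0 u uU) addr0.
Qed.

(* For [h] of weight 1 on [w j] and 2 on the other [w i], the eigenvalue 1 of
   [R_h] on [U] is simple, as the eigenvalues on [U,U] are at least 2. *)
Lemma simultaneous_eigenvector (j : 'I_n) : exists x,
  [/\ x \in U, (W j.+1 <= W j + <[x]>)%VS &
      forall h, h \in H -> exists c, bra x h = c *: x].
Proof.
have [[W0 Wn] hW wW wtP _] := fW.
have [h1 _ wh1] := weight_surj (\row_i (if i == j then 1 else 2%:R)).
have [h hH wh] := centralizer_representative h1; rewrite {}wh1 in wh.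
have hg0 := subvP centralizer_even _ hH.
have [i|_ hUU] := weight_rspec_ge1 hg0.
  by rewrite wh mxE; case: ifP => // _; rewrite ler1n.
have hS i k : (i <= k <= n)%N -> (k <= j)%N || (j < i)%N ->
    rspec (fun c : K => 2 <= c) h (W k) (W i).
  move=> ik kj; apply: (weight_flag_rspec iU fW) => // o /andP[io ok].
  have oj : o != j by apply: contraTneq kj => <-; rewrite leqNgt ok ltnNge io.
  by rewrite wh mxE (negPf oj).
(* Below step j only weights 2 and eigenvalues on [U,U] occur, so 1 is not an eigenvalue on [W j];
   the next fact does the same above [W j.+1]. *)
have hWj : rspec (fun c : K => 2 <= c) h (W j) 0%VS.
  apply: rspec_trans (hS 0%N j _ _) _; rewrite ?leqnn ?W0 //=; exact: ltnW.
have hUW : rspec (fun c : K => 2 <= c) h U (W j.+1).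
  by rewrite -Wn; apply: hS; rewrite ?leqnn ?ltn_ord ?orbT.
have n21 : ~ (2%:R <= 1 :> K) by rewrite (ler_nat K 2 1).
have inj v : v \in W j -> bra v h = v -> v = 0.
  move=> vW vh; apply/eqP; rewrite -memv0.
  by apply: (rspec_eigen hWj vW (c := 1)); rewrite ?scale1r.
have WU i : (i <= n)%N -> (W i <= U)%VS.
  by move=> lin; rewrite -Wn (weight_flag_mono fW) // lin leqnn.
have djS : (\dim (W j.+1) = (\dim (W j)).+1)%N.
  rewrite (hW j) dimv_disjoint_sum ?capv_line0 // dim_vline.
  by case: eqP (wW j) => [->|_ _]; rewrite ?mem0v ?addn1.
(* Since h has weight 1 on [w j], R_h - 1 maps [W j.+1] into [W j], of smaller dimension, so its
   kernel there is nonzero. *)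
pose T : 'End(L) := (linfun (brar h) - \1)%VF.
have TE v : T v = bra v h - v by rewrite add_lfunE opp_lfunE id_lfunE lfunE.
have TW : (T @: W j.+1 <= W j)%VS.
  apply/subvP => _ /memv_imgP[v + ->]; rewrite (hW j) TE.
  case/memv_addP => a aW [_ /vlineP[c ->] ->].
  rewrite braDl braZl opprD addrACA -scalerBr.
  rewrite memvD ?memvB ?memvZ ?(weight_flag_stable iU fW) //; first exact: ltnW.
  by have := wtP j h hg0; rewrite wh mxE eqxx scale1r.
have [x xW x0] : exists2 x, x \in (W j.+1 :&: lker T)%VS & x != 0.
  exists (vpick (W j.+1 :&: lker T)); rewrite ?memv_pick // vpick0 -dimv_eq0.
  apply/eqP => d0; have := limg_ker_dim T (W j.+1).
  by rewrite d0 djS add0n => dT; have := dimvS TW; rewrite dT ltnn.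
move: xW => /memv_capP[xW]; rewrite memv_ker TE subr_eq0 => /eqP xh.
have xWj : x \notin W j by apply: contra x0 => xWj; apply/eqP; apply: inj.
have Wx : (W j.+1 <= W j + <[x]>)%VS.
  have /eqP <- // : (W j + <[x]>)%VS == W j.+1.
  rewrite eqEdim subv_add -memvE xW (hW j) addvSl /= -(hW j).
  by rewrite djS dimv_disjoint_sum ?capv_line0 // dim_vline x0 addn1.
have xU : x \in U by apply: subvP xW; apply: WU.
exists x; split=> // h' h'H.
(* As h' commutes with h, [x,h'] again has eigenvalue 1. It therefore lies in [W j.+1], and its
   component in [W j] vanishes. *)
have eig : bra (bra x h') h = bra x h'.
  by rewrite brar_derivation // xh (centralizer_abelian h'H hH) bra0r addr0.
have : bra x h' \in W j.+1.
  by apply: (rspec_eigen hUW (braU _ _) (c := 1)); rewrite ?scale1r.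
move=> /(subvP Wx)/memv_addP[a aW [_ /vlineP[c ->] xh'E]].
suff a0 : a = 0 by exists c; rewrite xh'E a0 add0r.
apply: inj => //; move: eig; rewrite xh'E braDl braZl xh.
by move/addIr.
Qed.

(** The simultaneous eigenvectors, one for each step of the flag, span U modulo [U,U]; their
    brackets supply the remaining eigenvectors. *)
Lemma centralizer_diagonalizable h : h \in H ->
  exists2 b : seq L, <<b>>%VS = U &
    forall v, v \in b -> exists c, bra v h = c *: v.
Proof.
move=> hH; have [[W0 Wn] _ _ _ _] := fW.
have [x xP] := fin_all_exists simultaneous_eigenvector.
apply: (@eigen_generation _ _ _ _ (codom x)) => //.
- exact: (subvP centralizer_even).
- suff h' i : (i <= n)%N -> (W i <= brs U U + <<codom x>>)%VS by rewrite -{1}Wn h'.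
  elim: i => [|i IH] lt; first by rewrite W0 addvSl.
  have [_ hW _] := xP (Ordinal lt); apply: subv_trans hW _.
  rewrite subv_add IH ?(ltnW lt) // -memvE; apply: (subvP (addvSr _ _)).
  by apply: memv_span; apply: codom_f.
- by apply/span_subvP => _ /codomP[i ->]; have [] := xP i.
- by move=> _ /codomP[i ->]; have [_ _] := xP i; apply.
Qed.

End Centralizer.
End MaximalNilradical.

Section NilradicalTheorems.
Variables (K : numClosedFieldType) (L : lieSuperalgType K) (U : {vspace L}).
Hypotheses (nU : is_nilradical U) (LU : (brs {:L} {:L} <= U)%VS).
Let n := (\dim U - \dim (brs U U))%N.

Lemma codimv_nilradical : (codimv U <= n)%N.
Proof.
have [iU _ _] := nU; have [W [w [wt fW]]] := weight_flag_exists iU LU.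
exact: codimv_nilradical_flag fW.
Qed.

Lemma maximal_odd_brackets : codimv U = n ->
  (brs (grade true : {vspace L}) (grade true) <= brs (grade false) (grade false))%VS.
Proof.
have [iU _ _] := nU; have [W [w [wt fW]]] := weight_flag_exists iU LU.
exact: odd_brackets fW.
Qed.

(** [H] is the centralizer of a grading element. *)
Lemma maximal_torus_complement : codimv U = n ->
  exists H : {vspace L},
    [/\ (H <= grade false)%VS, (H :&: U = 0)%VS /\ (H + U = fullv)%VS,
        forall x y, x \in H -> y \in H -> bra x y = 0 &
        forall h, h \in H -> exists2 b : seq L, <<b>>%VS = U &
          forall v, v \in b -> exists c, bra v h = c *: v].
Proof.
move=> maxU; have [iU _ _] := nU; have [W [w [wt fW]]] := weight_flag_exists iU LU.
have [h0 h00 h0U] := grading_element nU LU fW maxU.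
exists (lker (linfun (brar h0))); split.
- exact: (centralizer_even nU LU h00 h0U).
- by split; [exact: (centralizer_cap h0U) | exact: (centralizer_add LU h0U)].
- exact: (centralizer_abelian LU h00 h0U).
- exact: (centralizer_diagonalizable nU LU fW).
Qed.

End NilradicalTheorems.

(** * Homomorphisms and torus extensions *)

Section Homomorphisms.
Variables (K : fieldType) (N L : lieSuperalgType K) (f : 'Hom(N, L)).
Hypothesis fH : lsa_hom f.
Implicit Types (x y : N) (X Y I : {vspace N}).

Lemma lsa_hom_grade i x : x \in grade i -> f x \in grade i.
Proof. by move=> xi; apply: (subvP (fH.1 i)); apply: memv_img. Qed.

Lemma limg_brs X Y : (f @: brs X Y = brs (f @: X) (f @: Y))%VS.
Proof.
have [_ fM] := fH; apply/eqP; rewrite eqEsubv; apply/andP; split.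
  apply/subvP => _ /memv_imgP[v + ->]; rewrite memv_preim; apply: subvP.
  by apply/brsP => x y xX yY; rewrite -memv_preim fM memv_brs // memv_img.
apply/brsP => _ _ /memv_imgP[x xX ->] /memv_imgP[y yY ->].
by rewrite -fM memv_img // memv_brs.
Qed.

Lemma limg_lower_central X m :
  (f @: lower_central X m = lower_central (f @: X) m)%VS.
Proof. by elim: m => //= m IH; rewrite limg_brs IH. Qed.

Lemma limg_nilpotent X : nilpotent_lsa X -> nilpotent_lsa (f @: X)%VS.
Proof. by move=> [m Xm]; exists m; rewrite -limg_lower_central Xm limg0. Qed.

Lemma limg_graded X : graded_subspace X -> graded_subspace (f @: X)%VS.
Proof.
move=> /graded_subspaceP gX; apply/graded_subspaceP => _ /memv_imgP[x xX ->].
have [x0 [x0X g0] [x1 [x1X g1] ->]] := gX x xX.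
exists (f x0); first by rewrite memv_img ?lsa_hom_grade.
by exists (f x1); rewrite ?linearD // memv_img ?lsa_hom_grade.
Qed.

Hypothesis f0 : lker f = 0%VS.

Lemma lsa_hom_inj : injective f.
Proof. by apply/lker0P; rewrite f0. Qed.

(** The image of the component of the wrong parity is both even and odd, hence zero, and injectivity
    applies. *)
Lemma lsa_hom_grade_inv i x : f x \in grade i -> x \in grade i.
Proof.
have [x0 g0 [x1 g1 ->]] := grade_dec x; rewrite linearD /=.
have fg0 := lsa_hom_grade g0; have fg1 := lsa_hom_grade g1.
case: i => fx.
  suff /lsa_hom_inj -> : f x0 = f 0 by rewrite add0r.
  rewrite linear0; apply: grade_eq0 => //.
  by rewrite -(addrK (f x1) (f x0)) memvB.
suff /lsa_hom_inj -> : f x1 = f 0 by rewrite addr0.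
rewrite linear0; apply: grade_eq0 => //.
by rewrite -(addKr (f x0) (f x1)) memvD // memvN.
Qed.

Lemma nilpotent_limg X : nilpotent_lsa (f @: X)%VS -> nilpotent_lsa X.
Proof.
move=> [m]; rewrite -limg_lower_central => fm; exists m; apply/eqP.
by rewrite -subv0 -(limg_ker0 (f := f)) ?f0 // fm limg0 subvv.
Qed.

Lemma dim_limg_inj X : (\dim (f @: X) = \dim X)%N.
Proof. by rewrite limg_dim_eq // f0 capv0. Qed.

Lemma dim_abelianization :
  (\dim (limg f) - \dim (brs (limg f) (limg f)) = codimv (brs {:N} {:N}))%N.
Proof. by rewrite -limg_brs !dim_limg_inj. Qed.

End Homomorphisms.

Lemma lsa_hom_comp (K : fieldType) (L1 L2 L3 : lieSuperalgType K)
    (f : 'Hom(L1, L2)) (g : 'Hom(L2, L3)) :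
  lsa_hom f -> lsa_hom g -> lsa_hom (g \o f)%VF.
Proof.
move=> fH gH; split=> [i|x y]; last by rewrite !comp_lfunE fH.2 gH.2.
apply/subvP => _ /memv_imgP[x xi ->]; rewrite comp_lfunE.
by apply: (lsa_hom_grade gH); apply: (lsa_hom_grade fH).
Qed.

Section Isomorphisms.
Variable K : fieldType.
Implicit Types L : lieSuperalgType K.

Lemma lsa_isom_sym L1 L2 : lsa_isom L1 L2 -> lsa_isom L2 L1.
Proof.
move=> [f [fH f0 fT]]; have fK : cancel f f^-1%VF by apply: lker0_lfunK; rewrite f0.
have fVK y : f (f^-1%VF y) = y by apply: limg_lfunVK; rewrite fT memvf.
exists f^-1%VF; split.
- split=> [i|x y].
    apply/subvP => _ /memv_imgP[y yi ->].
    by apply: (lsa_hom_grade_inv fH f0); rewrite fVK.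
  by apply: (lsa_hom_inj f0); rewrite fH.2 !fVK.
- apply/eqP; rewrite -subv0; apply/subvP => y; rewrite memv_ker => /eqP y0.
  by rewrite -(fVK y) y0 linear0 mem0v.
- apply/eqP; rewrite eqEsubv subvf; apply/subvP => x _.
  by rewrite -(fK x) memv_img ?memvf.
Qed.

Lemma limg_graded_ideal L1 L2 (f : 'Hom(L1, L2)) (I : {vspace L1}) :
  lsa_hom f -> limg f = fullv -> graded_ideal I -> graded_ideal (f @: I)%VS.
Proof.
move=> fH fT [gI iI]; split; first exact: limg_graded.
by rewrite -fT -limg_brs // limgS.
Qed.

Lemma limg_nilradical L1 L2 (f : 'Hom(L1, L2)) (U : {vspace L1}) :
  lsa_hom f -> lker f = 0%VS -> limg f = fullv ->
  is_nilradical U -> is_nilradical (f @: U)%VS.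
Proof.
move=> fH f0 fT [iU nU maxU]; split.
- exact: limg_graded_ideal.
- exact: limg_nilpotent.
move=> I iI nI.
(* A nilpotent ideal of the target is pulled back, compared with U, and pushed forward again. *)
have preK : (f @: (f @^-1: I) = I)%VS by apply: lpreimK; rewrite fT subvf.
rewrite -preK limgS //; apply: maxU; last by apply: (nilpotent_limg fH f0); rewrite preK.
split.
  apply/graded_subspaceP => x; rewrite -memv_preim => fxI.
  have [x0 g0 [x1 g1 xE]] := grade_dec x; have [gI _] := iI.
  have [y0 [y0I h0] [y1 [y1I h1]]] := (graded_subspaceP I).1 gI _ fxI.
  rewrite xE linearD /= => fE.
  have d0 : f x0 - y0 = 0.
    apply: grade_eq0; first by rewrite memvB // (lsa_hom_grade fH).
    have -> : f x0 - y0 = y1 - f x1.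
      by apply/eqP; rewrite subr_eq addrAC eq_sym subr_eq fE addrC.
    by rewrite memvB // (lsa_hom_grade fH).
  move/eqP: d0; rewrite subr_eq0 => /eqP fx0.
  have fx1 : f x1 = y1 by move: fE; rewrite fx0 => /addrI.
  by exists x0; [|exists x1]; rewrite -?memv_preim ?fx0 ?fx1.
apply/brsP => x y; rewrite -!memv_preim fH.2 => fxI _.
by have [_ /brsP h] := iI; apply: h; rewrite ?memvf.
Qed.

Lemma nilradical_unique L (U U' : {vspace L}) :
  is_nilradical U -> is_nilradical U' -> U = U'.
Proof.
move=> [i n m] [i' n' m']; apply/eqP; rewrite eqEsubv.
by apply/andP; split; [apply: m' | apply: m].
Qed.

(** The first derived term lies in U; from there the derived series is bounded by the lower central
    series of U, with indices shifted by one. *)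
Lemma solvable_of_nilpotent L (U : {vspace L}) : graded_ideal U ->
  nilpotent_lsa U -> (brs {:L} {:L} <= U)%VS -> solvable_lsa {:L}.
Proof.
move=> iU [m Um] LU; exists m.+1; apply/eqP; rewrite -subv0 -Um.
elim: m {Um} => [|m IH] //.
apply: brs_mono => //; apply: subv_trans IH (lower_central_sub m iU).
Qed.

End Isomorphisms.

(** * The nilradical of a torus extension *)

Section TorusExtensionNilradical.
Variables (K : fieldType) (N : lieSuperalgType K) (T : {vspace 'End(N)}).
Hypotheses (hT : torus T) (nilN : nilpotent_lsa {:N}).
Local Notation R := (torus_ext hT).

Definition ext_in (x : N) : R := (x, 0).

Lemma ext_in_linear : linear ext_in.
Proof. by move=> a x y; congr pair; rewrite /= scaler0 addr0. Qed.

HB.instance Definition _ := GRing.isLinear.Build K N R _ ext_in ext_in_linear.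

Definition ext_inj : 'Hom(N, R) := linfun ext_in.

Lemma ext_injE x : ext_inj x = (x, 0).
Proof. by rewrite lfunE. Qed.

Lemma ext_inj_hom : lsa_hom ext_inj.
Proof.
split=> [i|x y].
  apply/subvP => _ /memv_imgP[x xi ->]; rewrite ext_injE.
  exact/(ext_gradeP hT).
by rewrite !ext_injE; congr pair; rewrite /= !zero_lfunE addr0 subr0.
Qed.

Lemma ext_inj_ker : lker ext_inj = 0%VS.
Proof.
apply/eqP; rewrite -subv0; apply/subvP => x.
by rewrite memv_ker ext_injE memv0 => /eqP[->].
Qed.

Lemma ext_injP (u : R) : (u \in limg ext_inj) = (u.2 == 0).
Proof.
apply/idP/eqP => [/memv_imgP[x _ ->]|]; first by rewrite ext_injE.
by case: u => x d /= ->; rewrite -ext_injE memv_img ?memvf.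
Qed.

Lemma ext_brs : (brs {:R} {:R} <= limg ext_inj)%VS.
Proof. by apply/brsP => u v _ _; rewrite ext_injP. Qed.

Lemma codimv_ext : codimv (limg ext_inj) = \dim T.
Proof.
pose p : 'Hom(R, subvs_of T) := linfun (snd : R -> subvs_of T).
have -> : limg ext_inj = lker p.
  by apply/vspaceP => u; rewrite ext_injP memv_ker lfunE.
rewrite /codimv -(limg_ker_dim p) capfv addKn.
have -> : limg p = fullv.
  apply/eqP; rewrite eqEsubv subvf; apply/subvP => d _.
  have -> : d = p (0, d) by rewrite lfunE.
  by rewrite memv_img ?memvf.
by rewrite dimvf.
Qed.

(** If a nilpotent ideal contains x + d, then d cannot have a nonzero eigenvalue; being
    diagonalizable, d is 0. *)
Lemma ext_nilradical : is_nilradical (limg ext_inj).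
Proof.
split; first split.
- exact: (limg_graded ext_inj_hom (@graded_fullv _ N)).
- by apply: subv_trans ext_brs; apply: brs_mono; rewrite subvf.
- exact: (limg_nilpotent ext_inj_hom nilN).
move=> I [_ /brsP iI] [m Im]; apply/subvP => -[x d] uI; rewrite ext_injP /=.
have [evT diT _] := hT; have [_ dM] := evT _ (subvsP d).
have iN : graded_ideal {:N} by split; [exact: graded_fullv | exact: subvf].
have [b /andP[/eqP bT _] eb] := diT _ (subvsP d).
suff h v c : vsval d v = c *: v -> vsval d v = 0.
  apply/eqP/val_inj/lfunP => v /=; rewrite zero_lfunE.
  have vb : v \in <<b>>%VS by rewrite bT memvf.
  rewrite (coord_span (X := in_tuple b) vb) linear_sum big1 // => i _.
  have /eb[c] : b`_i \in b by apply: mem_nth.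
  by move=> /h; rewrite linearZ /= => ->; rewrite scaler0.
move=> dv; have [c0|c0] := eqVneq c 0; first by rewrite dv c0 scale0r.
(* An eigenvector with c nonzero is shown to lie in every term of the lower central series of N,
   hence to be 0. *)
suff vm k : v \in lower_central {:N} k.
  have [j Nj] := nilN; have := vm j; rewrite Nj memv0 => /eqP->.
  by rewrite linear0.
have dN j y : y \in lower_central {:N} j -> vsval d y \in lower_central {:N} j.
  elim: j y => [|j IH] y; first by rewrite !memvf.
  rewrite memv_preim; apply: subvP; apply/brsP => y1 y2 h1 h2.
  by rewrite -memv_preim dM memvD // memv_brs ?IH ?memvf.
elim: k => [|k IH]; first exact: memvf.
(* Repeated brackets of v with x + d multiply it by powers of c, up to an error z one term deeper in
   the series of N. At j = m the bracket is 0, so v itself lies one term deeper. *)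
have it j : exists2 z, z \in lower_central {:N} k.+1 &
    ((c ^+ j.+1 *: v + z, 0) : R) \in lower_central I j.
  elim: j => [|j [z zk hz]].
    exists (- bra x v).
      rewrite memvN; apply: (subvP (lower_central_lsub k iN)).
      by rewrite memv_brs ?memvf.
    have -> : ((c ^+ 1 *: v - bra x v, 0) : R) = - bra ((x, d) : R) ((v, 0) : R).
      congr pair; last by rewrite /= oppr0.
      by rewrite /= zero_lfunE addr0 dv opprB expr1.
    by rewrite memvN; apply: iI; rewrite ?memvf.
  have zk' : z \in lower_central {:N} k.
    exact: (subvP (lower_central_ideal k iN)).
  exists (bra (c ^+ j.+1 *: v + z) x + vsval d z).
    by rewrite memvD ?dN // memv_brs ?memvf // memvD ?memvZ.
  have -> : ((c ^+ j.+2 *: v + (bra (c ^+ j.+1 *: v + z) x + vsval d z), 0) : R)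
      = bra ((c ^+ j.+1 *: v + z, 0) : R) ((x, d) : R).
    congr pair; rewrite /= zero_lfunE subr0 linearD linearZ /= dv scalerA -exprSr.
    by rewrite addrCA.
  by rewrite /= memv_brs.
have [z zk] := it m; rewrite Im memv0 => /eqP[] /eqP.
rewrite addr_eq0 => /eqP cz.
have : c ^+ m.+1 *: v \in lower_central {:N} k.+1 by rewrite cz memvN.
move/(memvZ (c ^+ m.+1)^-1); rewrite scalerA mulVf ?scale1r //.
by rewrite expf_neq0.
Qed.

End TorusExtensionNilradical.

(** * The splitting *)

(** Diagonalizability asks for a basis of eigenvectors, whereas the construction gives only a
    spanning list. *)
Lemma basis_of_spanning (K : fieldType) (E : vectType K) (b : seq E) :
  exists2 b' : seq E, basis_of <<b>>%VS b' & {subset b' <= b}.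
Proof.
elim: b => [|x b [b' bb' sb]].
  by exists [::] => //; rewrite basisEfree nil_free subvv span_nil dimv0.
have [xb|xb] := boolP (x \in <<b>>%VS).
  exists b'; last by move=> y /sb; rewrite inE orbC => ->.
  suff -> : <<x :: b>>%VS = <<b>>%VS by [].
  by rewrite span_cons; apply/addv_idPr; rewrite -memvE.
exists (x :: b'); last first.
  by move=> y; rewrite !inE => /orP[->//|/sb ->]; rewrite orbT.
have [/eqP sb' fb'] := andP bb'.
by rewrite /basis_of free_cons fb' sb' xb !span_cons sb' eqxx.
Qed.

(** The extension of N by T has nilradical N and codimension dim T, so the bound on the codimension
    of a nilradical applies. *)
Lemma dim_torus_le (K : numClosedFieldType) (N : lieSuperalgType K)
    (T : {vspace 'End(N)}) : nilpotent_lsa {:N} -> torus T ->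
  (\dim T <= codimv (brs {:N} {:N}))%N.
Proof.
move=> nN hT; rewrite -(codimv_ext hT) -(dim_abelianization (ext_inj_hom hT)).
  by apply: codimv_nilradical; [exact: ext_nilradical | exact: ext_brs].
exact: ext_inj_ker.
Qed.

Section Splitting.
Variables (K : numClosedFieldType) (N L : lieSuperalgType K) (f : 'Hom(N, L)).
Hypotheses (fH : lsa_hom f) (f0 : lker f = 0%VS).
Let U := limg f.
Hypotheses (nU : is_nilradical U) (LU : (brs {:L} {:L} <= U)%VS).
Variable H : {vspace L}.
Hypotheses (H0 : (H <= grade false)%VS) (HU : (H :&: U = 0)%VS)
  (HUT : (H + U = fullv)%VS)
  (HH : forall x y, x \in H -> y \in H -> bra x y = 0)
  (diH : forall h, h \in H -> exists2 b : seq L, <<b>>%VS = U &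
     forall v, v \in b -> exists c, bra v h = c *: v).

Let fI := lsa_hom_inj f0.
Let fK : cancel f f^-1%VF. Proof. by apply: lker0_lfunK; rewrite f0. Qed.
Let fVK u : u \in U -> f (f^-1%VF u) = u. Proof. exact: limg_lfunVK. Qed.
Let fU x : f x \in U. Proof. by rewrite memv_img ?memvf. Qed.

(** The derivation of N is transported from right multiplication by h, to fit the convention [x,d] =
    d(x) of torus extensions. *)
Definition pull_ad (h : subvs_of H) : 'End(N) :=
  (f^-1 \o linfun (brar (vsval h)) \o f)%VF.

Lemma pull_adE h x : f (pull_ad h x) = bra (f x) (vsval h).
Proof.
rewrite !comp_lfunE lfunE fVK //; apply: (subvP LU).
by rewrite memv_brs ?memvf.
Qed.

Lemma pull_ad_linear : linear pull_ad.
Proof.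
move=> a h h'; apply/lfunP => x; apply: fI.
rewrite add_lfunE scale_lfunE [RHS]linearD /= [f (_ *: _)]linearZ /= !pull_adE.
by rewrite !linearP.
Qed.

HB.instance Definition _ := GRing.isLinear.Build K (subvs_of H) 'End(N) _
  pull_ad pull_ad_linear.

Let D : 'Hom(subvs_of H, 'End(N)) := linfun pull_ad.
Let T := limg D.

Let DE h x : f (D h x) = bra (f x) (vsval h).
Proof. by rewrite lfunE pull_adE. Qed.

Let Heven (h : subvs_of H) : vsval h \in grade false.
Proof. exact: (subvP H0 _ (subvsP h)). Qed.

(** An element of [H] that annihilates U acts nilpotently on U, so it lies in U and in [H], which
    meet in 0. *)
Let D0 : lker D = 0%VS.
Proof.
apply/eqP; rewrite -subv0; apply/subvP => h; rewrite memv_ker => /eqP Dh.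
rewrite memv0 -(inj_eq val_inj) /= -memv0 -HU memv_cap subvsP /=.
apply: (nilradical_ad_nilpotent nU LU (Heven h)); exists [:: 0].
  by move=> c; rewrite inE => /eqP.
move=> _ /memv_imgP[x _ ->]; rewrite !rshiftE scale0r subr0 -DE Dh.
by rewrite zero_lfunE linear0 mem0v.
Qed.

Lemma pull_ad_torus : torus T.
Proof.
split=> [_ /memv_imgP[h _ ->]|_ /memv_imgP[h _ ->]|].
- split=> [i|x y].
    apply/subvP => _ /memv_imgP[x xi ->]; apply: (lsa_hom_grade_inv fH f0).
    by rewrite DE -(addbF i) bra_grade ?lsa_hom_grade.
  apply: fI; rewrite DE linearD /= !fH.2 !DE.
  exact: brar_derivation.
- have [b bU eb] := diH (subvsP h).
  have [b' bb' sb] := basis_of_spanning [seq f^-1%VF v | v <- b].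
  exists b'.
    suff -> : fullv = <<[seq f^-1%VF v | v <- b]>>%VS by [].
    apply/eqP; rewrite eqEsubv subvf andbT -limg_span bU.
    by apply/subvP => x _; rewrite -(fK x) memv_img.
  move=> v /sb/mapP[u ub ->]; have [c uc] := eb u ub; exists c; apply: fI.
  by rewrite DE linearZ /= fVK // -bU memv_span.
move=> _ _ /memv_imgP[h _ ->] /memv_imgP[h' _ ->]; apply/lfunP => x.
apply: fI; rewrite !comp_lfunE !DE brar_derivation //.
by rewrite (HH (subvsP h') (subvsP h)) bra0r addr0.
Qed.

Lemma dim_pull_ad_torus : \dim T = codimv U.
Proof.
rewrite limg_dim_eq; last by rewrite D0 capv0.
by rewrite /codimv -HUT dimv_disjoint_sum // addnK dimvf.
Qed.

Let hT := pull_ad_torus.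
Local Notation R := (torus_ext hT).

(** The element of [H] that induces the derivation d. *)
Let E (d : subvs_of T) : L := vsval (D^-1%VF (vsval d)).
Let E_H d : E d \in H. Proof. exact: subvsP. Qed.
Let D_E (d : subvs_of T) : D (D^-1%VF (vsval d)) = vsval d.
Proof. by apply: limg_lfunVK; apply: subvsP. Qed.
Let f_E (d : subvs_of T) x : f (vsval d x) = bra (f x) (E d).
Proof. by rewrite -D_E DE. Qed.

Definition ext_to (u : R) : L := f u.1 + E u.2.

Lemma ext_to_linear : linear ext_to.
Proof.
have EL : linear E by move=> a d e; rewrite /E !linearP.
move=> a u v; rewrite -[LHS]/(f (a *: u.1 + v.1) + E (a *: u.2 + v.2)).
by rewrite EL linearP /ext_to scalerDr addrACA.
Qed.

HB.instance Definition _ := GRing.isLinear.Build K R L _ ext_to ext_to_linear.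

(** The map is built from N + T to L, where x + d |-> f(x) + E(d) is explicit, and then inverted. *)
Lemma ext_to_isom : lsa_isom L R.
Proof.
apply: lsa_isom_sym; exists (linfun ext_to).
have E0 : E 0 = 0 by rewrite /E !linear0.
split; first split=> [i|u v].
- apply/subvP => _ /memv_imgP[u /(ext_gradeP hT)[u1 u2] ->]; rewrite lfunE /=.
  apply: memvD; first exact: (lsa_hom_grade fH).
  case: i {u1} u2 => [/(_ isT) ->|_]; first by rewrite E0 mem0v.
  exact: (subvP H0).
(* The term -d(y) of the extension bracket corresponds to [E d, f y] = -[f y, E d], valid as E d is
   even. *)
- rewrite !lfunE /= /ext_to /= E0 addr0 linearB linearD /= fH.2 !f_E.
  rewrite !braDl !braDr (HH (E_H _) (E_H _)) addr0.
  by rewrite (bra_skew_even (f v.1) (subvP H0 _ (E_H u.2))).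
- apply/eqP; rewrite -subv0; apply/subvP => -[x d]; rewrite memv_ker lfunE /=.
  rewrite /ext_to /= => /eqP xd.
  have Ed : E d = 0.
    apply/eqP; rewrite -memv0 -HU memv_cap E_H /=.
    by rewrite -(addKr (f x) (E d)) xd addr0 memvN.
  move: xd; rewrite Ed addr0 -(linear0 f) => /fI ->.
  suff -> : d = 0 by rewrite mem0v.
  apply: val_inj => /=; rewrite -D_E.
  suff -> : D^-1%VF (vsval d) = 0 by rewrite linear0.
  exact: val_inj.
apply/eqP; rewrite eqEsubv subvf; apply/subvP => v _.
have : v \in (H + U)%VS by rewrite HUT memvf.
case/memv_addP => h hH [_ /memv_imgP[x _ ->] ->].
pose d : subvs_of T := vsproj T (D (vsproj H h)).
have Ed : E d = h.
  rewrite /E vsprojK ?memv_img ?memvf // lker0_lfunK ?D0 //.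
  by rewrite vsprojK.
have -> : h + f x = linfun ext_to ((x, d) : R).
  by rewrite lfunE /= /ext_to /= Ed addrC.
by rewrite memv_img ?memvf.
Qed.

End Splitting.

(** * Maximal rank and maximal extensions *)

Section MaximalRankTheorem.
Variable K : numClosedFieldType.
Implicit Types N L : lieSuperalgType K.

Lemma maximal_rank_splitting N L (U : {vspace L}) :
  is_nilradical U -> (brs {:L} {:L} <= U)%VS -> lsa_isom_onto N U ->
  codimv U = codimv (brs {:N} {:N}) ->
  exists (T : {vspace 'End(N)}) (hT : torus T),
    [/\ maximal_torus T, of_maximal_rank T & lsa_isom L (torus_ext hT)].
Proof.
move=> nU LU [f [fH f0 fE]] dU.
rewrite -(dim_abelianization fH f0) fE in dU.
have [H [H0 [HU HUT] HH diH]] := maximal_torus_complement nU LU dU.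
rewrite -fE (dim_abelianization fH f0) in nU LU dU HU HUT diH.
have hT := pull_ad_torus fH f0 LU H0 HH diH.
have dT := dim_pull_ad_torus f0 nU LU H0 HU HUT.
eexists; exists (pull_ad_torus fH f0 LU H0 HH diH).
have nN : nilpotent_lsa {:N}.
  by apply: (nilpotent_limg fH f0); case: nU.
split; last exact: ext_to_isom.
(* The torus already attains the upper bound of [dim_torus_le], so a larger torus has the same
   dimension. *)
- split=> // T' hT' sT; apply/eqP; rewrite eq_sym eqEdim sT dT dU.
  exact: dim_torus_le.
- by rewrite /of_maximal_rank dT dU.
Qed.

Lemma codimv_solvable_extension N L (U : {vspace L}) :
  solvable_extension N U -> (codimv U <= codimv (brs {:N} {:N}))%N.
Proof.
move=> [_ nU [f [fH f0 fE]] [LU _]].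
by rewrite -(dim_abelianization fH f0) fE; apply: codimv_nilradical.
Qed.

(** A torus of full rank gives a competitor: the condition on odd brackets follows from
    [maximal_odd_brackets]. *)
Lemma torus_solvable_extension N (T : {vspace 'End(N)}) (hT : torus T) :
  nilpotent_lsa {:N} -> of_maximal_rank T ->
  solvable_extension N (limg (ext_inj hT)).
Proof.
move=> nN rT; have nU := ext_nilradical hT nN; have LU := @ext_brs _ _ _ hT.
have [iU nilU _] := nU; split=> //.
- exact: solvable_of_nilpotent iU nilU LU.
- by exists (ext_inj hT); split; [exact: ext_inj_hom | exact: ext_inj_ker |].
split=> //; apply: (maximal_odd_brackets nU LU).
rewrite codimv_ext rT (dim_abelianization (ext_inj_hom hT)) //.
exact: ext_inj_ker.
Qed.

Lemma maximal_rank_iff L (U : {vspace L}) :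
  solvable_lsa {:L} -> is_nilradical U -> bracket_conditions U ->
  solvable_of_maximal_rank L <->
  exists N, nilpotent_of_maximal_rank N /\ maximal_solvable_extension N L.
Proof.
move=> sL nU bU; split=> [[N [T [hT [nN mT rT LR]]]]|[N [[nN [T [hT mT] rT]] [V]]]].
  exists N; split; first by split=> //; exists T.
  have [g [gH g0 gT]] := lsa_isom_sym LR.
  (* Both sides are nilradicals of L, so uniqueness identifies them. *)
  have UE : U = limg (g \o ext_inj hT)%VF.
    rewrite limg_comp; apply: nilradical_unique nU _.
    by apply: limg_nilradical => //; apply: ext_nilradical.
  have ext_inj0 := @ext_inj_ker _ _ _ hT.
  have f0 : lker (g \o ext_inj hT)%VF = 0%VS.
    apply/eqP/lker0P => x y; rewrite !comp_lfunE => /(lsa_hom_inj g0).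
    exact: (lsa_hom_inj ext_inj0).
  have cU : codimv U = codimv (brs {:N} {:N}).
    rewrite -rT -(codimv_ext hT) UE limg_comp /codimv -{1}gT.
    by rewrite !(dim_limg_inj g0).
  exists U; last by move=> L' U' /codimv_solvable_extension; rewrite cU.
  split=> //; exists (g \o ext_inj hT)%VF; split=> //.
  exact: lsa_hom_comp (ext_inj_hom hT) gH.
move=> eV maxV; have := codimv_solvable_extension eV.
(* The torus extension bounds the maximal codimension from below by the rank of N; the general bound
   gives equality, and the splitting applies. *)
have := maxV _ _ (torus_solvable_extension hT nN rT).
rewrite codimv_ext rT => le1 le2.
have dV : codimv V = codimv (brs {:N} {:N}) by apply/eqP; rewrite eqn_leq le2.
have [_ nV iV [LV _]] := eV.
have [T' [hT' [mT' rT' LR]]] := maximal_rank_splitting nV LV iV dV.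
by exists N, T', hT'.
Qed.

End MaximalRankTheorem.

Theorem theorem4p10 (R : realType) (L : lieSuperalgType R[i])
    (N : {vspace L}) :
  solvable_lsa (fullv : {vspace L}) ->
  ~ nilpotent_lsa (fullv : {vspace L}) ->
  is_nilradical N ->
  bracket_conditions N ->
  solvable_of_maximal_rank L <->
  exists N' : lieSuperalgType R[i],
    nilpotent_of_maximal_rank N' /\ maximal_solvable_extension N' L.
Proof.
move=> sL _ nN bN; exact: (@maximal_rank_iff R[i] L N).
Qed.
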